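(* Let $p$ be a prime and let $A$ and $A'$ be two Abelian $p$-groups. Write $A=D\oplus\overline A$ and $A'=D'\oplus\overline{A'}$ with $D,D'$ divisible and $\overline A,\overline{A'}$ reduced. Let $\varkappa_0,\varkappa_0'$ be the ranks of $D$ and $D'$, so $D\cong\bigoplus_{\varkappa_0}\mathbb Z(p^\infty)$ and $D'\cong\bigoplus_{\varkappa_0'}\mathbb Z(p^\infty)$. Let $B=\bigoplus_{i\ge1}B_i$ and $B'=\bigoplus_{i\ge1}B'_i$ be basic subgroups of $\overline A$ and $\overline{A'}$, where $B_i\cong\bigoplus_{\varkappa_i}\mathbb Z(p^i)$ and $B_i'\cong\bigoplus_{\varkappa_i'}\mathbb Z(p^i)$. Let $A^{\mathbf 1}$ and ${A'}^{\mathbf 1}$ be the first Ulm subgroups of $\overline A$ and $\overline{A'}$, and let $C=\bigoplus_{i\ge1}C_i$ and $C'=\bigoplus_{i\ge1}C_i'$ be basic subgroups of $A^{\mathbf 1}$ and ${A'}^{\mathbf 1}$, where $C_i\cong\bigoplus_{\gamma_i}\mathbb Z(p^i)$ and $C'_i\cong\bigoplus_{\gamma'_i}\mathbb Z(p^i)$. For cardinals $\mu,\nu$ write $\mu\approx\nu$ if either $\mu,\nu$ are both finite and equal, or both are infinite. Then $\mathrm{tp}(A)=\mathrm{tp}(A')$ if and only if $\varkappa_i\approx\varkappa_i'$ for all $i=1,2,\dots$, and one of the following two conditions holds: (i) both $\varkappa_0+\mathrm{fin}\,r(A^{\mathbf 1})$ and $\varkappa_0'+\mathrm{fin}\,r({A'}^{\mathbf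 1})$ are infinite; or (ii) $\varkappa_0=\varkappa_0'$ are finite, $\mathrm{fin}\,r(A^{\mathbf 1})=\mathrm{fin}\,r({A'}^{\mathbf 1})=0$, and there is a natural number $N$ such that $\gamma_k=\gamma_k'=0$ for all $k>N$ and $\sum_{k=i}^N\gamma_k\approx\sum_{k=i}^N\gamma_k'$ for all $i=1,\dots,N$.
   Context: Groups are considered in the first-order language of group theory. For a group $G$ and a finite tuple $(g_1,\dots,g_n)$ of elements of $G$, the type $\mathrm{tp}^G(g_1,\dots,g_n)$ is the set of all first-order formulas in free variables $x_1,\dots,x_n$ that are true on $(g_1,\dots,g_n)$ in $G$. $\mathrm{tp}(G)$ is the set of all types of finite tuples of elements of $G$. Groups $G,H$ are isotypic (isotypically equivalent) if $\mathrm{tp}(G)=\mathrm{tp}(H)$. An Abelian group is reduced if it has no nonzero divisible subgroups; every Abelian $p$-group is the direct sum of its divisible part (the largest divisible subgroup, isomorphic to a direct sum of copies of the Prüfer group $\mathbb Z(p^\infty)$) and a reduced group. $\mathbb Z(p^n)$ is the cyclic group of order $p^n$. A subgroup $G$ of $A$ is pure if $nG=G\cap nA$ for all integers $n$. A basic subgroup of an Abelian $p$-group $A$ is a pure subgroup $B$ which is a direct sum of cyclic $p$-groups and such that $A/B$ is divisible; basic subgroups always exist and are unique up to isomorphism. The first Ulm subgroup of a reduced $p$-group $\overline A$ is $\bigcap_{n\ge1}p^n\overline A$. The rank of a $p$-group is the cardinality of a maximal independent system of elements (of prime power orders), equivalently the dimension over $\mathbb Z/p$ of its $p$-socle; a system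 is independent if for any finitely many of its elements $a_1,\dots,a_n$ and integers $m_i$, $\sum m_ia_i=0$ implies $m_ia_i=0$ for every $i$. The final rank $\mathrm{fin}\,r(G)$ of a $p$-group $G$ is the minimum of the cardinals $\mathrm{rank}(p^nG)$, $n=1,2,\dots$. *)

(* Defs.v *)
From HB Require Import structures.
From mathcomp Require Import all_boot all_order all_algebra.
From mathcomp Require Import boolp classical_sets functions cardinality.
From mathcomp Require Import -(notations) monalg.

Set Implicit Arguments.
Unset Strict Implicit.
Unset Printing Implicit Defensive.

Import GRing.Theory.
Local Open Scope classical_set_scope.
Local Open Scope card_scope.
Local Open Scope ring_scope.

(* First-order language of groups.  [formula n] is the set of formulas whose
   free variables are among [n] variables indexed by ['I_n]; a quantifier over
   [phi : formula n.+1] binds the last variable [ord_max]. *)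

Inductive term (n : nat) : Type :=
| Var of 'I_n
| Unit
| Op of term n & term n
| Inv of term n.

Inductive formula : nat -> Type :=
| Eq n of term n & term n : formula n
| Not n of formula n : formula n
| And n of formula n & formula n : formula n
| Or n of formula n & formula n : formula n
| Imp n of formula n & formula n : formula n
| Forall n of formula n.+1 : formula n
| Exists n of formula n.+1 : formula n.

Section Semantics.
Variable G : zmodType.

(* Abelian groups are written additively. *)
Fixpoint eval n (v : 'I_n -> G) (t : term n) : G :=
  match t with
  | Var i => v i
  | Unit => 0
  | Op s t => eval v s + eval v t
  | Inv t => - eval v t
  end.

Definition extend n (v : 'I_n -> G) (x : G) : 'I_n.+1 -> G :=
  fun i => if unlift ord_max i is Some j then v j else x.

Fixpoint holds n (phi : formula n) : ('I_n -> G) -> Prop :=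
  match phi in formula m return ('I_m -> G) -> Prop with
  | Eq _ s t => fun v => eval v s = eval v t
  | Not _ f => fun v => ~ holds f v
  | And _ f g => fun v => holds f v /\ holds g v
  | Or _ f g => fun v => holds f v \/ holds g v
  | Imp _ f g => fun v => holds f v -> holds g v
  | Forall _ f => fun v => forall x : G, holds f (extend v x)
  | Exists _ f => fun v => exists x : G, holds f (extend v x)
  end.

Definition tp_tuple n (g : n.-tuple G) : set (formula n) :=
  [set phi | holds phi (tnth g)].

Definition tp : set {n : nat & set (formula n)} :=
  [set T | exists n (g : n.-tuple G), T = existT _ n (tp_tuple g)].

End Semantics.

(* Cardinals are represented by types (or by subsets of a type), compared with
   the relations [#=] and [#<=] of the library. *)

Definition card_approx T U (X : set T) (Y : set U) : Prop :=
  [/\ finite_set X, finite_set Y & X #= Y] \/ (infinite_set X /\ infinite_set Y).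

Section Subgroups.
Variable A : zmodType.
Implicit Types (G H B : set A) (x y : A).

Definition is_subgroup H : Prop :=
  H 0 /\ forall x y, H x -> H y -> H (x - y).

Definition mulset (n : int) G : set A := [set x *~ n | x in G].

Definition divisible G : Prop := forall n : int, n != 0 -> mulset n G = G.

Definition reduced G : Prop :=
  forall H, is_subgroup H -> H `<=` G -> divisible H -> H = [set 0].

Definition is_pure B G : Prop := forall n : int, mulset n B = B `&` mulset n G.

(* Divisibility of the quotient [G / B]. *)
Definition divisible_quotient G B : Prop :=
  forall n : int, n != 0 ->
    forall x, G x -> exists2 y, G y & B (x - y *~ n).

(* [x] has order [n] (infinite order when [n = 0]). *)
Definition has_order x (n : nat) : Prop :=
  forall m : nat, (x *+ m == 0) = (n %| m)%N.

Definition p_group (p : nat) G : Prop :=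
  forall x, G x -> exists k : nat, has_order x (p ^ k).

Definition cyclic_subgroup x : set A := range (fun m : int => x *~ m).

Definition direct_sum (I : choiceType) (S : I -> set A) B : Prop :=
  [/\ forall i, is_subgroup (S i),
      B = [set x | exists (s : seq I) (f : I -> A),
             [/\ uniq s, forall i, S i (f i) & x = \sum_(i <- s) f i]]
    & forall (s : seq I) (f : I -> A), uniq s -> (forall i, S i (f i)) ->
        \sum_(i <- s) f i = 0 -> forall i, i \in s -> f i = 0].

Definition direct_sum2 (D R G : set A) : Prop :=
  [/\ is_subgroup D, is_subgroup R, D `&` R = [set 0]
    & G = [set x | exists d r, [/\ D d, R r & x = d + r]]].

Definition sum_of_cyclic_p_groups (p : nat) B : Prop :=
  exists (I : choiceType) (c : I -> A),
    (forall i, exists k : nat, has_order (c i) (p ^ k)) /\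
    direct_sum (fun i => cyclic_subgroup (c i)) B.

Definition is_basic (p : nat) B G : Prop :=
  [/\ is_subgroup B, B `<=` G, is_pure B G,
      sum_of_cyclic_p_groups p B & divisible_quotient G B].

Definition first_ulm (p : nat) G : set A :=
  \bigcap_(n in [set n : nat | (0 < n)%N]) mulset (p ^ n)%N G.

(* The order of an element is required to be [p ^ k] with [0 < k], so that
   [0] belongs to no independent system. *)
Definition independent (p : nat) G (X : set A) : Prop :=
  [/\ X `<=` G,
      forall x, X x -> exists2 k : nat, (0 < k)%N & has_order x (p ^ k)
    & forall (s : seq A) (m : A -> int), uniq s -> (forall a, a \in s -> X a) ->
        \sum_(a <- s) a *~ m a = 0 -> forall a, a \in s -> a *~ m a = 0].

Definition maximal_independent (p : nat) G (X : set A) : Prop :=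
  independent p G X /\
  forall Y : set A, independent p G Y -> X `<=` Y -> Y = X.

Definition has_rank (p : nat) G (K : Type) : Prop :=
  exists2 X, maximal_independent p G X & [set: K] #= X.

Definition has_final_rank (p : nat) G (K : Type) : Prop :=
  (exists2 n : nat, (0 < n)%N & has_rank p (mulset (p ^ n)%N G) K) /\
  (forall (n : nat) (X : set A), (0 < n)%N ->
     maximal_independent p (mulset (p ^ n)%N G) X -> [set: K] #<= X).

Definition iso_to H (E : zmodType) : Prop :=
  exists2 f : {additive E -> A}, injective f & range f = H.

End Subgroups.

(* The direct sum of [K] copies of Z(p^i), for [p ^ i > 1]: the group of finitely
   supported functions from [K] to ['Z_(p ^ i)]. *)
Definition dsum_cyclic (p i : nat) (K : choiceType) : zmodType :=
  @malg K 'Z_(p ^ i).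

(* The decomposition is indexed by [i >= 1]: [Bi 0] and [kappa 0] are irrelevant. *)
Definition basic_decomposition (p : nat) (A : zmodType) (G B : set A)
    (Bi : nat -> set A) (kappa : nat -> choiceType) : Prop :=
  [/\ is_basic p B G,
      direct_sum (fun i : nat => Bi i.+1) B
    & forall i : nat, (0 < i)%N -> iso_to (Bi i) (dsum_cyclic p i (kappa i))].

(* The sum of the cardinals [gamma k], [i <= k <= N]. *)
Definition interval_sum (gamma : nat -> choiceType) (i N : nat) :
    set {k : nat & gamma k} :=
  [set x | (i <= tag x <= N)%N].
Arguments interval_sum : clear implicits.

(* Main.v *)
(* Since tuples of a p-group A generate finite subgroups, their positive primitive
   types amount to finite subgroups together with heights truncated at omega.  A
   Baur-Monk elimination of quantifiers shows that tp(A) = tp(A') as soon as every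
   finite subgroup of A embeds in A' with its truncated heights, and conversely.

   Such embeddings exist when the Ulm invariants of finite index, i.e. the
   dimensions of p^h A[p] / p^(h+1) A[p], and the dimensions of the socles of
   p^i W, for W = p^omega A, agree up to the distinction between infinite
   cardinals: the elements of infinite height are embedded first, layer by layer,
   and the others by the steps of Kaplansky's proof of Ulm's theorem.  These
   dimensions can be read off the types of tuples.

   The Ulm invariants are the kappa_(h+1), read off a basic subgroup.  As
   W = D + A^1, and as a reduced group some p^i-multiple of which has a finite
   socle is bounded, either all the socles of the p^i W are infinite, or A^1 is
   bounded, hence equal to C, and the socle of p^i W has dimension
   kappa_0 + sum_(k > i) gamma_k. *)
Require Import Defs.
From Stdlib Require Eqdep_dec.
From HB Require Import structures.
From mathcomp Require Import all_boot all_order all_algebra.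
From mathcomp Require Import boolp classical_sets functions cardinality.
From mathcomp Require Import -(notations) monalg.
Set Implicit Arguments.
Unset Strict Implicit.
Unset Printing Implicit Defensive.
Import GRing.Theory.
Local Open Scope classical_set_scope.
Local Open Scope card_scope.

(** * Finite subgroups and additive maps on them *)

(** Ulm's theorem needs countability to exhaust the groups. Here only finite subgroups are embedded:
    finitely many steps suffice, and each asks for one new element outside a finite subgroup. So a
    dimension enters only through the statements that it is at least [m], and agreement of these for
    all [m] means equal or both infinite. Formulas see heights below omega only, so elements of
    infinite height need only be sent to elements of infinite height. But to pass from p^(i+1) Y to
    p^i Y, for Y finite in W, the images must lie in p^(i+1) W', where roots in p^i W' exist; hence
    the socles of all the p^i W are invariants. Once the elements of infinite height are embedded,
    the other cosets have bounded heights and Kaplansky's argument runs on natural numbers. When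
    kappa_0 is finite and A^1 is bounded, the socle of p^i W is that of D for large i; this isolates
    kappa_0, and cancelling it elsewhere leaves the sums of gamma_k. A nonzero final rank of A^1 is
    infinite, whence the zero in (ii). *)

Section FiniteSubgroups.
Local Open Scope ring_scope.
Variable A : zmodType.
Implicit Types (X S : seq A) (x y z : A).

(** Duplicate-free lists: their lengths bound the inductions on subgroups, and their elements are
    counted in [pp_realize]. *)
Definition fsub X : Prop :=
  [/\ uniq X, 0 \in X & forall x y, x \in X -> y \in X -> x - y \in X].

Lemma fsub_zero : fsub [:: 0].
Proof.
split=> //; first by rewrite inE.
by move=> x y; rewrite !inE => /eqP -> /eqP ->; rewrite subrr.
Qed.

Lemma fsub0 X : fsub X -> 0 \in X. Proof. by case. Qed.

Lemma fsubB X x y : fsub X -> x \in X -> y \in X -> x - y \in X.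
Proof. by case=> _ _; apply. Qed.

Lemma fsubN X x : fsub X -> x \in X -> - x \in X.
Proof. by move=> Xs xX; rewrite -sub0r; apply: fsubB => //; apply: fsub0. Qed.

Lemma fsubD X x y : fsub X -> x \in X -> y \in X -> x + y \in X.
Proof. by move=> Xs xX yX; rewrite -[y]opprK; apply/fsubB/fsubN. Qed.

Lemma fsubMn X x n : fsub X -> x \in X -> x *+ n \in X.
Proof.
move=> Xs xX; elim: n => [|n IH]; first exact: fsub0.
by rewrite mulrS; apply: fsubD.
Qed.

Lemma fsubMz X x n : fsub X -> x \in X -> x *~ n \in X.
Proof.
move=> Xs xX; case: n => n; first exact: fsubMn.
by rewrite NegzE mulrNz; apply/fsubN/fsubMn.
Qed.

Lemma fsub_sum X (I : Type) (r : seq I) (f : I -> A) :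
  fsub X -> (forall i, f i \in X) -> \sum_(i <- r) f i \in X.
Proof.
move=> Xs fX; elim/big_rec: _ => [|i x _ xX]; first exact: fsub0.
exact: fsubD.
Qed.

Lemma fsubDl X x y : fsub X -> x \in X -> (x + y \in X) = (y \in X).
Proof.
move=> Xs xX; apply/idP/idP => [xyX|]; last exact: fsubD.
by rewrite -[y](addKr x) addrC; apply: fsubB.
Qed.

End FiniteSubgroups.

(** [f] is total, with arbitrary values outside [X], so that extending a map to a larger subgroup
    does not change its type. *)
Definition addon (A A' : zmodType) (X : seq A) (f : A -> A') : Prop :=
  forall x y, x \in X -> y \in X -> f (x - y)%R = (f x - f y)%R.

Section Addon.
Local Open Scope ring_scope.
Variables (A A' : zmodType) (X : seq A) (f : A -> A').
Hypotheses (Xs : fsub X) (fX : addon X f).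

Lemma addon0 : f 0 = 0.
Proof. by rewrite -[in LHS](subrr 0) fX ?subrr //; apply: fsub0. Qed.

Lemma addonN x : x \in X -> f (- x) = - f x.
Proof. by move=> xX; rewrite -sub0r fX ?addon0 ?sub0r //; apply: fsub0. Qed.

Lemma addonD x y : x \in X -> y \in X -> f (x + y) = f x + f y.
Proof.
move=> xX yX; rewrite -[in LHS](opprK y) fX ?addonN ?opprK //.
exact: fsubN.
Qed.

Lemma addonMn x n : x \in X -> f (x *+ n) = f x *+ n.
Proof.
move=> xX; elim: n => [|n IH]; first exact: addon0.
by rewrite !mulrS addonD ?IH //; apply: fsubMn.
Qed.

Lemma addonMz x n : x \in X -> f (x *~ n) = f x *~ n.
Proof.
move=> xX; case: n => n; first exact: addonMn.
by rewrite NegzE !mulrNz -!pmulrn addonN ?addonMn //; apply: fsubMn.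
Qed.

Lemma addon_sum (I : Type) (r : seq I) (g : I -> A) :
  (forall i, g i \in X) -> f (\sum_(i <- r) g i) = \sum_(i <- r) f (g i).
Proof.
move=> gX; elim: r => [|i r IH]; first by rewrite !big_nil addon0.
by rewrite !big_cons addonD ?IH //; apply: fsub_sum.
Qed.

Lemma addon_sub Y : {subset Y <= X} -> addon Y f.
Proof. by move=> YX x y /YX xX /YX yX; apply: fX. Qed.

End Addon.

Section IntegerFacts.
Local Open Scope ring_scope.
Variables (p : nat) (p_prime : prime p).

Lemma bezout_coprime (n : int) h : ~~ (p %| n)%Z ->
  exists m k : int, m * n + k * (p ^ h)%N%:Z = 1.
Proof.
move=> pn; have cop : coprimez n (p ^ h)%N%:Z.
  rewrite /coprimez /gcdz eqz_nat !absz_nat -/(coprime _ _).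
  by rewrite coprime_sym coprimeXl // prime_coprime.
have [u [v uv]] := Bezoutz n (p ^ h)%N%:Z.
by exists u, v; rewrite uv; apply/eqP.
Qed.

Lemma bezout_prime (n : int) : ~~ (p %| n)%Z ->
  exists m k : int, m * n + k * p%:Z = 1.
Proof.
by move=> /(bezout_coprime 1) [m [k]]; rewrite expn1; exists m, k.
Qed.

Lemma mulz_bezout (A : zmodType) (x : A) (m n k q : int) :
  m * n + k * q = 1 -> x = x *~ n *~ m + x *~ q *~ k.
Proof.
by move=> e; rewrite -!mulrzA -mulrzDr [n * m]mulrC [q * k]mulrC e mulr1z.
Qed.

Lemma dvd_annihil (A : zmodType) (x : A) (n : int) : x *+ p = 0 -> (p %| n)%Z -> x *~ n = 0.
Proof. by move=> x0 /dvdzP[q ->]; rewrite mulrC mulrzA -pmulrn x0 mul0rz. Qed.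

Lemma annihil_dvd (A : zmodType) (x : A) (n : int) :
  x *+ p = 0 -> x != 0 -> x *~ n = 0 -> (p %| n)%Z.
Proof.
move=> px x0 nx; apply/negPn/negP => /bezout_prime[m [k e]].
by move: x0; rewrite (mulz_bezout x e) nx -pmulrn px !mul0rz addr0 eqxx.
Qed.

End IntegerFacts.

(** * Adjoining one element to a finite subgroup *)

Definition torsion (p : nat) (A : zmodType) :=
  forall x : A, exists k, (x *+ (p ^ k) = 0)%R.

Section Torsion.
Local Open Scope ring_scope.
Variables (p : nat) (p_prime : prime p) (A : zmodType) (Ap : torsion p A).
Implicit Types (X S : seq A) (x y z : A).

Lemma mulrn_modn x q n : x *+ q = 0 -> x *+ n = x *+ (n %% q).
Proof. by move=> xq; rewrite {1}(divn_eq n q) mulrnDr mulnC mulrnA xq mul0rn add0r. Qed.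

Lemma fsub_adjoin X c : fsub X -> exists X', [/\ fsub X', {subset X <= X'}, c \in X'
  & forall z, z \in X' -> exists s (n : int), s \in X /\ z = s + c *~ n].
Proof.
move=> Xs; have [k ck] := Ap c.
set q := (p ^ k)%N in ck; have q0 : (0 < q)%N by rewrite expn_gt0 prime_gt0.
pose X' := undup [seq s + c *+ n | s <- X, n <- iota 0 q].
have X'P z : z \in X' -> exists s (n : int), s \in X /\ z = s + c *~ n.
  rewrite mem_undup => /allpairsP[[s n] /= [sX _ ->]].
  by exists s, n%:Z.
have inX' s n : s \in X -> s + c *+ n \in X'.
  move=> sX; rewrite mem_undup (mulrn_modn n ck); apply/allpairsP.
  by exists (s, n %% q)%N; rewrite mem_iota ltn_mod q0.
have inX'z s (n : int) : s \in X -> s + c *~ n \in X'.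
  move=> sX; case: n => n; first exact: inX'.
  (* A negative multiple becomes a natural one by adding a multiple of the exponent [q] of [c]. *)
  rewrite NegzE mulrNz -pmulrn (_ : - _ = c *+ (q * n.+1 - n.+1)); first exact: inX'.
  rewrite mulrnBr; last by rewrite leq_pmull.
  by rewrite mulrnA ck mul0rn sub0r.
exists X'; split => //; first split.
- exact: undup_uniq.
- by rewrite -[0](addr0 0) -[X in _ + X](mulr0n c); apply: inX'; exact: fsub0.
- move=> x y /X'P[s [n [sX ->]]] /X'P[t [m [tX ->]]].
  by rewrite opprD addrACA -mulrzBr; apply: inX'z; exact: fsubB.
- by move=> x xX; rewrite -[x]addr0 -[X in _ + X](mulr0n c); apply: inX'.
- by rewrite -[c]add0r -[X in _ + X]mulr1n; apply: inX'; exact: fsub0.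
Qed.

Lemma fsub_gen (L : seq A) : exists X, fsub X /\ {subset L <= X}.
Proof.
elim: L => [|c L [X [Xs LX]]].
  by exists [:: 0]; split=> //; apply: fsub_zero.
have [X' [X's XX' cX' _]] := fsub_adjoin c Xs.
by exists X'; split=> // x; rewrite inE => /orP[/eqP-> //|/LX/XX'].
Qed.

(** The last of x, p x, p^2 x, ... outside [S]. Thanks to it, maps are only ever extended by an
    element of order [p] modulo the subgroup. *)
Lemma step_below S x : fsub S -> x \notin S -> exists n, x *+ n \notin S /\ x *+ n *+ p \in S.
Proof.
move=> Ss xS; have [k xk] := Ap x.
have ex : exists k, x *+ (p ^ k) \in S by exists k; rewrite xk fsub0.
case: (ex_minnP ex) => -[|m] mS mmin; first by rewrite expn0 mulr1n (negbTE xS) in mS.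
exists (p ^ m)%N; split; last by rewrite -mulrnA -expnSr.
by apply/negP => /mmin; rewrite ltnn.
Qed.

Lemma coef_dvd S x (n : int) : fsub S -> x \notin S -> x *+ p \in S -> x *~ n \in S -> (p %| n)%Z.
Proof.
move=> Ss xS pxS nxS; apply/negPn/negP => /(bezout_prime p_prime)[m [k e]].
case/negP: xS; rewrite (mulz_bezout x e) -pmulrn.
by apply: fsubD => //; apply: fsubMz.
Qed.

(** Modulo [S], [x] generates a group of order at most [p], so a multiple of [x] outside [S] gives
    back [x] after multiplication by an inverse of [n] modulo [p]. Heights and kernels then need
    checking only on [S] and on the coset [x + S]. *)
Lemma adjoin_cases S x s (n : int) : fsub S -> x *+ p \in S -> s \in S ->
  s + x *~ n \in S \/
  exists2 m : int, ~~ (p %| m)%Z & exists2 t, t \in S & (s + x *~ n) *~ m = x + t.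
Proof.
move=> Ss pxS sS; have [/dvdzP[q ->]|pn] := boolP (p %| n)%Z.
  by left; rewrite fsubDl // mulrC mulrzA; apply: fsubMz.
right; have [m [k e]] := bezout_prime p_prime pn; exists m.
  apply/negP => /dvdzP[q mq]; have : (p%:Z %| (1%R : int))%Z.
    by rewrite -e mq mulrAC -mulrDl dvdz_mull.
  by rewrite dvdz1 absz_nat => /eqP p1; move: p_prime; rewrite p1.
(* Since [m * n = 1 - k * p], the surplus multiple of [x *+ p] is absorbed in [t]. *)
exists (s *~ m - x *+ p *~ k); first by apply: fsubB => //; apply: fsubMz.
rewrite mulrzDl addrCA -mulrzA [n * m]mulrC; congr (_ + _).
have -> : m * n = 1 - k * p%:Z by rewrite -e addrK.
by rewrite mulrzBr mulr1z [k * _]mulrC mulrzA.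
Qed.

Lemma extend_hom (A' : zmodType) (f : A -> A') S x (y : A') :
    fsub S -> addon S f -> x \notin S -> x *+ p \in S -> y *+ p = f (x *+ p) ->
  exists g : A -> A', forall s (n : int), s \in S -> g (s + x *~ n) = f s + y *~ n.
Proof.
move=> Ss fS xS pxS ypx.
have /choice[g gP] : forall z, exists w, forall s (n : int), s \in S ->
    z = s + x *~ n -> w = f s + y *~ n.
  move=> z; have [[s [n [sS ->]]]|no] :=
    pselect (exists s (n : int), s \in S /\ z = s + x *~ n); last first.
    by exists 0 => s n sS zE; case: no; exists s, n.
  (* Two expressions of [z] have coefficients of [x] that differ by a multiple of [p], and there
     [y *+ p = f (x *+ p)] makes the values agree. *)
  exists (f s + y *~ n) => t m tS e.
  have eD : x *~ (n - m) = t - s.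
    by rewrite mulrzBr -[x *~ n](addKr s) e addrA addrK addrC.
  have /(coef_dvd Ss xS pxS)/dvdzP[q nm] : x *~ (n - m) \in S.
    by rewrite eD; apply: fsubB.
  have : f (t - s) = y *~ (n - m).
    rewrite -eD nm mulrC !mulrzA -!pmulrn ypx.
    by rewrite (addonMz Ss fS).
  rewrite fS // mulrzBr => /eqP; rewrite subr_eq => /eqP ->.
  by rewrite addrAC subrK addrC.
by exists g => s n sS; apply: gP.
Qed.

End Torsion.

(** * Positive primitive formulas and elimination of quantifiers *)

Inductive pp : forall n, formula n -> Prop :=
| ppEq n (s t : term n) : pp (Eq s t)
| ppAnd n (f g : formula n) : pp f -> pp g -> pp (And f g)
| ppEx n (f : formula n.+1) : pp f -> pp (Exists f).

Section PositivePrimitive.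
Local Open Scope ring_scope.
Variable G : zmodType.

Lemma evalB n (v w : 'I_n -> G) (t : term n) :
  eval (fun i => v i - w i) t = eval v t - eval w t.
Proof.
elim: t => //= [|s -> t ->|t ->]; first by rewrite subr0.
  by rewrite opprD addrACA.
by rewrite opprB opprK addrC.
Qed.

Lemma extendB n (v w : 'I_n -> G) x y :
  extend (fun i => v i - w i) (x - y) = fun i => extend v x i - extend w y i.
Proof. by apply/funext => i; rewrite /extend; case: unlift. Qed.

Lemma ppB n (f : formula n) : pp f -> forall v w : 'I_n -> G,
  holds f v -> holds f w -> holds f (fun i => v i - w i).
Proof.
elim=> {n f} [n s t|n f g _ IHf _ IHg|n f _ IH] v w /=.
- by rewrite !evalB => -> ->.
- by move=> [? ?] [? ?]; split; [apply: IHf | apply: IHg].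
- by move=> [x xP] [y yP]; exists (x - y); rewrite extendB; apply: IH.
Qed.

(** The solutions form a subgroup by [ppB], so a nonempty fibre over [v] is a coset of the fibre
    over 0. *)
Lemma pp_coset n (f : formula n.+1) (v : 'I_n -> G) x y : pp f ->
  holds f (extend v x) -> holds f (extend v y) <-> holds f (extend (fun=> 0) (y - x)).
Proof.
move=> fpp fx.
have diff (w z : 'I_n -> G) u : (forall i, w i - z i = 0) ->
    (fun i => extend w u i - extend z x i) = extend (fun=> 0) (u - x).
  by move=> wz; rewrite -extendB; congr extend; apply/funext.
have vv i : v i - v i = 0 by rewrite subrr.
have f0 : holds f (extend (fun=> 0) (0 : G)) by have := ppB fpp fx fx; rewrite diff // subrr.
split=> [fy|fyx]; first by rewrite -(diff _ _ _ vv); apply: ppB.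
have -> : extend v y = fun i => extend v x i -
    (extend (fun=> 0) 0 i - extend (fun=> 0) (y - x) i).
  apply/funext => i; rewrite /extend; case: unlift => [j|]; first by rewrite !subr0.
  by rewrite sub0r opprK addrC subrK.
by apply: ppB => //; apply: ppB.
Qed.

Definition big_and n (fs : seq (formula n)) : formula n :=
  foldr (@And n) (Eq (Unit n) (Unit n)) fs.

Lemma holds_big_and n (I : eqType) (F : I -> formula n) r (v : 'I_n -> G) :
  holds (big_and (map F r)) v <-> {in r, forall i, holds (F i) v}.
Proof.
elim: r => [|i r [IH1 IH2]] //=; split=> [[Fi /IH1 Fr] j|Fr].
  by rewrite inE => /orP[/eqP->|/Fr].
split; first by apply: Fr; rewrite mem_head.
by apply: IH2 => j jr; apply: Fr; rewrite inE jr orbT.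
Qed.

End PositivePrimitive.

Lemma pp_big_and n (I : Type) (F : I -> formula n) r :
  (forall i, pp (F i)) -> pp (big_and (map F r)).
Proof. by move=> Fpp; elim: r => [|i r IH]; constructor. Qed.

(** * Inclusion and exclusion *)

Section Counting.

(** Counts of conjunctions determine all counts of Boolean profiles: excluding one more condition
    [j] subtracts the count with [j] added to the conjunction. *)
Lemma count_inclusion_exclusion (T T' I : eqType) (X : seq T) (X' : seq T')
    (P : I -> pred T) (P' : I -> pred T') :
    (forall J, count (fun z => all (P^~ z) J) X = count (fun z => all (P'^~ z) J) X') ->
  forall L J, count (fun z => all (P^~ z) J && ~~ has (P^~ z) L) X =
              count (fun z => all (P'^~ z) J && ~~ has (P'^~ z) L) X'.
Proof.
move=> PJ; elim=> [|j L IH] J /=.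
  rewrite (eq_count (a2 := fun z => all (P^~ z) J)); last by move=> z /=; rewrite andbT.
  by rewrite PJ; apply: eq_count => z; rewrite /= andbT.
have split_count S (Q : I -> pred S) (Y : seq S) :
    count (fun z => all (Q^~ z) J && ~~ (Q j z || has (Q^~ z) L)) Y
    = (count (fun z => all (Q^~ z) J && ~~ has (Q^~ z) L) Y
       - count (fun z => all (Q^~ z) (j :: J) && ~~ has (Q^~ z) L) Y)%N.
  have := count_predUI (fun z => all (Q^~ z) J && ~~ (Q j z || has (Q^~ z) L))
    (fun z => all (Q^~ z) (j :: J) && ~~ has (Q^~ z) L) Y.
  rewrite (eq_count (a1 := predI _ _) (a2 := pred0)); last first.
    by move=> z /=; case: (Q j z); case: (has _ L); rewrite ?andbF.
  rewrite count_pred0 addn0 (eq_count (a1 := predU _ _)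
    (a2 := fun z => all (Q^~ z) J && ~~ has (Q^~ z) L)) => [->|z /=].
    by rewrite addnK.
  by case: (Q j z); case: (all _ J); case: (has _ L).
by rewrite !split_count !IH.
Qed.

End Counting.

Section BackAndForth.
Local Open Scope ring_scope.
Variables (p : nat) (p_prime : prime p).

Definition pp_some n (I : finType) (S : I -> formula n.+1) (J : {set I}) : formula n :=
  Exists (big_and (map S (enum J))).

Lemma count_translate (A : zmodType) (X : seq A) (Q : pred A) z : fsub X -> z \in X ->
  count (fun w => Q (w - z)) X = count Q X.
Proof.
move=> Xs zX; rewrite -(count_map (fun w => w - z) Q).
apply/permP/uniq_perm; first by rewrite map_inj_uniq; [case: Xs | apply: addIr].
  by case: Xs.
move=> w; apply/mapP/idP => [[x xX ->]|wX]; first exact: fsubB.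
by exists (w + z); [apply: fsubD | rewrite addrK].
Qed.

(* Inside a finite subgroup containing the relevant solutions, the positive
   primitive conditions over [a] and over [b] define cosets of the same
   subgroups with the same intersection pattern; counting then replaces the
   covering lemma of B.H. Neumann used for general modules. *)
Lemma pp_realize (G : zmodType) n (I : finType) (S : I -> formula n.+1) (a b : 'I_n -> G) :
    torsion p G -> (forall i, pp (S i)) ->
    (forall J, holds (pp_some S J) a <-> holds (pp_some S J) b) ->
  forall c, exists d, forall i, holds (S i) (extend a c) <-> holds (S i) (extend b d).
Proof.
move=> Gp Spp ab c.
have solve (v : 'I_n -> G) : exists z : {set I} -> G, forall J,
    holds (pp_some S J) v -> {in J, forall i, holds (S i) (extend v (z J))}.
  suff /choice[z zP] : forall J, exists z, holds (pp_some S J) v ->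
      {in J, forall i, holds (S i) (extend v z)} by exists z.
  move=> J.
  have [[z /holds_big_and zP]|no] := pselect (holds (pp_some S J) v); last by exists 0.
  by exists z => _ i iJ; apply: zP; rewrite mem_enum.
have [za zaP] := solve a; have [zb zbP] := solve b.
(* [X] contains a solution over [a] and one over [b] of each solvable conjunction, so that every
   nonempty solution set is, inside [X], a translate by an element of [X]. *)
have [X [Xs LX]] := fsub_gen p_prime Gp
  (c :: [seq za J | J : {set I}] ++ [seq zb J | J : {set I}]).
have zaX J : za J \in X.
  by apply: LX; rewrite inE mem_cat map_f ?orbT // mem_enum.
have zbX J : zb J \in X.
  by apply: LX; rewrite inE mem_cat orbC map_f ?orbT // mem_enum.
pose P (v : 'I_n -> G) i z := `[< holds (S i) (extend v z) >].
have cnt (v : 'I_n -> G) (z : G) (J : seq I) : z \in X ->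
    {in J, forall i, holds (S i) (extend v z)} ->
    count (fun w => all (P v ^~ w) J) X = count (fun w => all (P (fun=> 0) ^~ w) J) X.
  move=> zX zJ; rewrite -[RHS](count_translate _ Xs zX).
  apply: eq_count => w; apply: eq_in_all => i iJ.
  by apply: asbool_equiv_eq; apply: pp_coset => //; apply: zJ.
have cnt0 (v : 'I_n -> G) (J : seq I) : ~ holds (pp_some S [set i in J]) v ->
    count (fun w => all (P v ^~ w) J) X = 0%N.
  move=> no; apply/eqP; rewrite -leqn0 leqNgt -has_count; apply/hasPn => w _.
  apply/negP => /allP wJ; apply: no; exists w; apply/holds_big_and => i.
  by rewrite mem_enum inE => /wJ/asboolP.
have sizes J : count (fun w => all (P a ^~ w) J) X = count (fun w => all (P b ^~ w) J) X.
  have [aJ|naJ] := pselect (holds (pp_some S [set i in J]) a); last first.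
    by rewrite !cnt0 // => /ab.
  have bJ := proj1 (ab _) aJ.
  rewrite (cnt a (za [set i in J])) ?(cnt b (zb [set i in J])) //.
    by move=> i iJ; apply: (zbP _ bJ); rewrite inE.
  by move=> i iJ; apply: (zaP _ aJ); rewrite inE.
(* The elements counted are those with exactly the profile of [c]. Over [a] there is one, namely
   [c], hence there is one over [b]. *)
have := count_inclusion_exclusion sizes [seq i <- enum I | ~~ P a i c]
  [seq i <- enum I | P a i c].
set na := count _ _; set nb := count _ _ => nab.
have : (0 < nb)%N.
  rewrite -nab -has_count; apply/hasP; exists c; first by rewrite LX // mem_head.
  apply/andP; split; first by apply/allP => i; rewrite mem_filter => /andP[].
  by apply/hasPn => i; rewrite mem_filter => /andP[].
rewrite -has_count => /hasP[d _ /= /andP[/allP posd /hasPn negd]].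
exists d => i; split=> [ai|bi].
  by apply/asboolP/posd; rewrite mem_filter mem_enum andbT; apply/asboolP.
apply: contrapT => ai; have /negd /asboolP // : i \in [seq i <- enum I | ~~ P a i c].
by rewrite mem_filter mem_enum andbT; apply/asboolPn.
Qed.

Definition pp_realizes (G H : zmodType) : Prop := forall L : seq G,
  exists g : G -> H, forall n (f : formula n) (v : 'I_n -> G), pp f ->
    (forall i, v i \in L) -> holds f v <-> holds f (g \o v).

Lemma comp_extend (G H : zmodType) (g : G -> H) n (v : 'I_n -> G) x :
  g \o extend v x = extend (g \o v) (g x).
Proof. by apply/funext => i; rewrite /extend /=; case: unlift. Qed.

(** [c] is first carried into [H] together with [a]; the image of [a] solves the same conjunctions
    as [b], which reduces the claim to two tuples of the single group [H]. *)
Lemma pp_step (G H : zmodType) n (I : finType) (S : I -> formula n.+1)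
    (a : 'I_n -> G) (b : 'I_n -> H) :
    torsion p H -> pp_realizes G H -> (forall i, pp (S i)) ->
    (forall J, holds (pp_some S J) a <-> holds (pp_some S J) b) ->
  forall c, exists d, forall i, holds (S i) (extend a c) <-> holds (S i) (extend b d).
Proof.
move=> Hp GH Spp ab c; have [g gP] := GH (c :: codom a).
have be J : holds (pp_some S J) (g \o a) <-> holds (pp_some S J) b.
  rewrite -ab -gP // => [|i]; first by constructor; apply: pp_big_and.
  by rewrite inE codom_f orbT.
have [d dP] := pp_realize Hp Spp be (g c).
exists d => i; rewrite -dP -comp_extend; apply: gP => // j.
by rewrite /extend; case: unlift => [k|]; rewrite inE ?codom_f ?orbT ?eqxx.
Qed.

(** A semantic substitute for equivalence to a Boolean combination of positive primitive formulas,
    for both groups at once; no such combination is ever written down. *)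
Definition pp_determined (G H : zmodType) n (f : formula n) : Prop :=
  exists (I : finType) (S : I -> formula n), (forall i, pp (S i)) /\
    forall (a : 'I_n -> G) (b : 'I_n -> H),
      (forall i, holds (S i) a <-> holds (S i) b) -> holds f a <-> holds f b.

Theorem pp_elimination (G H : zmodType) : torsion p G -> torsion p H ->
  pp_realizes G H -> pp_realizes H G -> forall n (f : formula n), pp_determined G H f.
Proof.
move=> Gp Hp GH HG n0 f0.
have binary n' (f g : formula n') (h : formula n') :
    (forall (a : 'I_n' -> G) (b : 'I_n' -> H), (holds f a <-> holds f b) ->
       (holds g a <-> holds g b) -> (holds h a <-> holds h b)) ->
    pp_determined G H f -> pp_determined G H g -> pp_determined G H h.
  move=> fgh [I [S [Spp Sf]]] [J [T [Tpp Tg]]].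
  exists (I + J)%type, (fun k => match k with inl i => S i | inr j => T j end).
  split=> [[]|a b ST] //; apply: fgh; first by apply: Sf => i; apply: (ST (inl i)).
  by apply: Tg => j; apply: (ST (inr j)).
have quantifier n' (f : formula n'.+1) (h : formula n') :
    (forall (a : 'I_n' -> G) (b : 'I_n' -> H),
       (forall c, exists d, holds f (extend a c) <-> holds f (extend b d)) ->
       (forall d, exists c, holds f (extend a c) <-> holds f (extend b d)) ->
       (holds h a <-> holds h b)) ->
    pp_determined G H f -> pp_determined G H h.
  move=> fh [I [S [Spp Sf]]].
  (* Tuples that agree on the solvability of all conjunctions of the [S i] can be prolonged, back
     and forth, to tuples that agree on each [S i]. *)
  exists {set I}, (pp_some S); split=> [J|a b ST].
    by constructor; apply: pp_big_and.
  apply: fh => [c|d].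
    by have [d dP] := pp_step Hp GH Spp ST c; exists d; apply: Sf.
  have TS J : holds (pp_some S J) b <-> holds (pp_some S J) a by rewrite ST.
  by have [c cP] := pp_step Gp HG Spp TS d; exists c; apply: Sf => i; rewrite cP.
elim: f0 => {n0} [n s t|n f IH|n f IHf g IHg|n f IHf g IHg|n f IHf g IHg|n f IH|n f IH].
- exists 'I_1, (fun=> Eq s t); split=> [_|a b /(_ ord0) //]; exact: ppEq.
- by apply: (binary _ f f) => // a b fab _ /=; rewrite fab.
- by apply: binary IHf IHg => // a b fab gab /=; rewrite fab gab.
- by apply: binary IHf IHg => // a b fab gab /=; rewrite fab gab.
- by apply: binary IHf IHg => // a b fab gab /=; rewrite fab gab.
- apply: quantifier IH => a b cd dc /=; split=> fa x.
    by have [c <-] := dc x.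
  by have [d ->] := cd x.
- apply: quantifier IH => a b cd dc /=; split=> -[x fx].
    by have [d /proj1 /(_ fx)] := cd x; exists d.
  by have [c /proj2 /(_ fx)] := dc x; exists c.
Qed.

End BackAndForth.

(** * Heights, and preservation of positive primitive formulas *)

Definition hge (p : nat) (A : zmodType) (h : nat) (x : A) : Prop :=
  exists y, x = (y *+ (p ^ h))%R.

Section Heights.
Local Open Scope ring_scope.
Variables (p : nat) (p_prime : prime p) (A : zmodType).
Implicit Types (X S : seq A) (x y z : A).

Lemma hge0n x : hge p 0 x.
Proof. by exists x; rewrite expn0 mulr1n. Qed.

Lemma hge0 h : hge p h (0 : A).
Proof. by exists 0; rewrite mul0rn. Qed.

Lemma hgeB h x y : hge p h x -> hge p h y -> hge p h (x - y).
Proof. by move=> [a ->] [b ->]; exists (a - b); rewrite mulrnBl. Qed.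

Lemma hgeN h x : hge p h x -> hge p h (- x).
Proof. by move=> xh; rewrite -sub0r; apply: hgeB => //; apply: hge0. Qed.

Lemma hgeD h x y : hge p h x -> hge p h y -> hge p h (x + y).
Proof. by move=> xh yh; rewrite -[y]opprK; apply/hgeB/hgeN. Qed.

Lemma hgeMz h x n : hge p h x -> hge p h (x *~ n).
Proof. by move=> [y ->]; exists (y *~ n); rewrite pmulrn mulrzAC. Qed.

Lemma hge_le k h x : (k <= h)%N -> hge p h x -> hge p k x.
Proof.
by move=> kh [y ->]; exists (y *+ (p ^ (h - k))); rewrite -mulrnA -expnD subnK.
Qed.

Lemma hgeMp h x : hge p h x -> hge p h.+1 (x *+ p).
Proof. by move=> [y ->]; exists y; rewrite -mulrnA -expnSr. Qed.

Lemma hge_divp h x : hge p h.+1 x -> exists2 y, hge p h y & x = y *+ p.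
Proof. by move=> [y ->]; exists (y *+ p ^ h); [exists y | rewrite -mulrnA -expnSr]. Qed.

Lemma hge_unit h x (n : int) : ~~ (p %| n)%Z -> hge p h (x *~ n) -> hge p h x.
Proof.
move=> /(bezout_coprime p_prime h)[m [k e]] hx; rewrite (mulz_bezout x e).
by apply: hgeD; apply: hgeMz => //; exists x.
Qed.

Lemma hge_sum h (I : Type) (r : seq I) (f : I -> A) :
  (forall i, hge p h (f i)) -> hge p h (\sum_(i <- r) f i).
Proof.
move=> fh; elim/big_rec: _ => [|i x _ xX]; first exact: hge0.
exact: hgeD.
Qed.

End Heights.

(** * Extension of additive maps and preservation of truth *)

Section Extension.
Local Open Scope ring_scope.
Variables (p : nat) (p_prime : prime p) (A A' : zmodType) (Ap : torsion p A).
Implicit Types (X S : seq A) (x : A).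

Lemma extend_addon (f : A -> A') S x (y : A') :
    fsub S -> addon S f -> x \notin S -> x *+ p \in S -> y *+ p = f (x *+ p) ->
  exists S' (g : A -> A'),
    [/\ [/\ fsub S', {subset S <= S'}, x \in S' & g x = y], addon S' g, {in S, g =1 f},
      forall z, z \in S' -> exists s (n : int), s \in S /\ z = s + x *~ n
    & forall z, z \in S' -> z \in S \/ exists (m : int) t,
        [/\ ~~ (p %| m)%Z, t \in S, z *~ m = x + t & g z *~ m = y + f t]].
Proof.
move=> Ss fS xS pxS ypx; have [S' [S's SS' xS' S'P]] := fsub_adjoin p_prime Ap x Ss.
have [g gP] := extend_hom p_prime Ss fS xS pxS ypx.
have gf s : s \in S -> g s = f s.
  by move=> sS; rewrite -[s]addr0 -{1}(mulr0z x) gP // mulr0z !addr0.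
have gS' : addon S' g.
  move=> _ _ /S'P[s [n [sS ->]]] /S'P[t [m [tS ->]]].
  rewrite opprD addrACA -mulrzBr !gP ?fS //; last exact: fsubB.
  by rewrite mulrzBr opprD addrACA.
have gx : g x = y.
  by rewrite -[x]add0r -[X in _ + X]mulr1z gP ?mulr1z ?(addon0 Ss fS) ?add0r //; apply: fsub0.
exists S', g; split=> // z zS'; have [s [n [sS zE]]] := S'P z zS'; subst z.
have [|[m pm [t tS e]]] := adjoin_cases p_prime n Ss pxS sS; first by left.
right; exists m, t; split=> //; rewrite -(addonMz S's gS') // e addrC.
by rewrite -[X in t + X]mulr1z gP // mulr1z addrC.
Qed.

Lemma size_adjoin S S' x : fsub S -> {subset S <= S'} -> x \notin S -> x \in S' ->
  (size S < size S')%N.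
Proof.
move=> [Su _ _] SS' xS xS'; apply: (@uniq_leq_size _ (x :: S)); first by rewrite /= xS.
by move=> z; rewrite inE => /orP[/eqP->|/SS'].
Qed.

(* Adjoining an element of order [p] modulo [S] costs one unit of height, so
   heights truncated at the number of steps suffice. *)
Lemma extend_truncated X N : fsub X -> forall S (f : A -> A'),
    fsub S -> addon S f -> {subset S <= X} -> (size X <= size S + N)%N ->
    (forall x n, x \in S -> (n <= N)%N -> hge p n x -> hge p n (f x)) ->
  exists2 g : A -> A', addon X g & {in S, g =1 f}.
Proof.
move=> Xs; elim: N => [|N IH] S f Ss fS SX sz fh.
  exists f => //; apply: (addon_sub fS); rewrite addn0 in sz.
  have [Su _ _] := Ss; have [_ SXe] := uniq_min_size Su SX sz.
  by move=> x; rewrite SXe.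
have [XS|/existsNP[x0 /not_implyP[x0X /negP x0S]]] := pselect {subset X <= S}.
  by exists f => //; apply: (addon_sub fS).
have [k []] := step_below Ap Ss x0S.
have : x0 *+ k \in X by apply: fsubMn.
move: {x0 x0X x0S} (x0 *+ k) => x0 x0X x0S px0S.
(* The representative of the coset [x0 + S] is chosen with the largest height, cut at [N.+1] as
   heights may be infinite. If then [x + t] has height n, so does [x], and hence [t]. *)
pose Q h := `[< (h <= N.+1)%N /\ exists2 s, s \in S & hge p h (x0 + s) >].
have exQ : exists h, Q h.
  by exists 0%N; apply/asboolP; split=> //; exists 0; [apply: fsub0 | apply: hge0n].
have Qle h : Q h -> (h <= N.+1)%N by move=> /asboolP[].
case: (ex_maxnP exQ Qle) => h /asboolP[hN [s0 s0S xh]] hmax.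
pose x := x0 + s0.
have xS : x \notin S by rewrite /x addrC fsubDl.
have xX : x \in X by apply: fsubD => //; apply: SX.
have pxS : x *+ p \in S by rewrite mulrnDl; apply: fsubD => //; apply: fsubMn.
have proper n s : s \in S -> (n <= N.+1)%N -> hge p n (x + s) -> (n <= h)%N.
  move=> sS nN xs; apply: hmax; apply/asboolP; split=> //.
  by exists (s0 + s); [apply: fsubD | rewrite addrA].
(* Heights are preserved up to [N.+1] on [x *+ p]; dividing by [p] leaves [N] for [y], which is the
   loss allowed at this step. *)
have [y ypx yh] : exists2 y, y *+ p = f (x *+ p) & hge p (minn h N) y.
  have : hge p (minn h N).+1 (x *+ p) by apply/hgeMp/(hge_le _ xh)/geq_minl.
  move=> /(fh _ _ pxS); rewrite ltnS geq_minr => /(_ isT) /hge_divp[y yh e].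
  by exists y.
have [S' [g [[S's SS' xS' _] gS' gf S'P S'Q]]] := extend_addon Ss fS xS pxS ypx.
have S'X : {subset S' <= X}.
  move=> _ /S'P[s [n [sS ->]]]; apply: fsubD => //; first exact: SX.
  exact: fsubMz.
have lt := size_adjoin Ss SS' xS xS'.
have [||g' g'X g'g] := IH S' g S's gS' S'X.
- by apply: leq_trans sz _; rewrite addnS -addSn leq_add2r.
- move=> z n zS' nN zn; have [zS|[m [t [pm tS e ge]]]] := S'Q z zS'.
    by rewrite gf //; apply: fh => //; apply: leqW.
  apply: (hge_unit p_prime pm); rewrite ge.
  have xtn : hge p n (x + t) by rewrite -e; apply: hgeMz.
  have nh : (n <= h)%N by apply: proper xtn => //; apply: leqW.
  have xn : hge p n x by apply: hge_le xh.
  have tn : hge p n t by rewrite -[t](addKr x) addrC; apply: hgeB.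
  apply: hgeD; first by apply: hge_le yh; rewrite leq_min nh.
  by apply: fh => //; apply: leqW.
by exists g' => // z zS; rewrite g'g ?gf //; apply: SS'.
Qed.

(** The witnesses of the quantifiers lie in a finite subgroup, and equations between its elements
    survive any map additive on it. *)
Lemma pp_witness n (f : formula n) : pp f -> forall v : 'I_n -> A, holds f v ->
  exists X, [/\ fsub X, forall i, v i \in X
    & forall g : A -> A', addon X g -> holds f (g \o v)].
Proof.
elim=> {n f} [n s t|n f g _ IHf _ IHg|n f _ IH] v /=.
- move=> st; have [X [Xs vX]] := fsub_gen p_prime Ap (codom v).
  have vX' i : v i \in X by apply: vX; apply: codom_f.
  have evX u : eval v u \in X.
    elim: u => //= [||u uX]; [exact: fsub0 | by move=> u uX w wX; apply: fsubD |].
    exact: fsubN.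
  exists X; split=> // g gX.
  have evg u : eval (g \o v) u = g (eval v u).
    elim: u => //= [|u -> w ->|u ->].
    + by rewrite (addon0 Xs gX).
    + by rewrite (addonD Xs gX).
    + by rewrite (addonN Xs gX).
  by rewrite !evg st.
- move=> [/IHf[X [Xs vX XP]] /IHg[Y [Ys vY YP]]].
  have [Z [Zs XYZ]] := fsub_gen p_prime Ap (X ++ Y).
  have XZ : {subset X <= Z} by move=> z zX; apply: XYZ; rewrite mem_cat zX.
  have YZ : {subset Y <= Z} by move=> z zY; apply: XYZ; rewrite mem_cat zY orbT.
  exists Z; split=> // [i|h hZ]; first exact: XZ.
  by split; [apply/XP/(addon_sub hZ) | apply/YP/(addon_sub hZ)].
- move=> [x /IH[X [Xs vX XP]]]; exists X; split=> // [i|g gX].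
    by have := vX (lift ord_max i); rewrite /extend liftK.
  by exists (g x); rewrite -comp_extend; apply: XP.
Qed.

Lemma pp_preserved S (f : A -> A') : fsub S -> addon S f ->
    (forall x n, x \in S -> hge p n x -> hge p n (f x)) ->
  forall n (phi : formula n) (v : 'I_n -> A), pp phi -> (forall i, v i \in S) ->
  holds phi v -> holds phi (f \o v).
Proof.
move=> Ss fS fh n phi v ppphi vS /(pp_witness ppphi)[Y [Ys vY YP]].
have [X [Xs SYX]] := fsub_gen p_prime Ap (S ++ Y).
have SX : {subset S <= X} by move=> z zS; apply: SYX; rewrite mem_cat zS.
have YX : {subset Y <= X} by move=> z zY; apply: SYX; rewrite mem_cat zY orbT.
have [g gX gf] := extend_truncated Xs Ss fS SX (leq_addl _ _)
  (fun x n xS _ => fh x n xS).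
have -> : f \o v = g \o v by apply/funext => i /=; rewrite gf.
exact/YP/(addon_sub gX).
Qed.

End Extension.

(** Only natural numbers [n] are tested: the position of an element beyond omega may change. *)
Definition height_embedding (p : nat) (A A' : zmodType) (S : seq A) (f : A -> A') : Prop :=
  [/\ addon S f, forall x, x \in S -> f x = 0%R -> x = 0%R
    & forall x n, x \in S -> hge p n x <-> hge p n (f x)].

(** Each direction is an instance of [pp_preserved], the second one for the inverse of [f] on the
    finite subgroup [map f S]. *)
Lemma height_embedding_pp (p : nat) (A A' : zmodType) (S : seq A) (f : A -> A') :
    prime p -> torsion p A -> torsion p A' -> fsub S -> height_embedding p S f ->
  forall n (phi : formula n) (v : 'I_n -> A), pp phi -> (forall i, v i \in S) ->
  holds phi v <-> holds phi (f \o v).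
Proof.
move=> p_prime Ap A'p Ss [fS f0 fh] n phi v ppphi vS; split.
  by apply: (pp_preserved p_prime Ap Ss fS) => // x m xS /fh; apply.
have finj x y : x \in S -> y \in S -> f x = f y -> x = y.
  move=> xS yS e; apply/eqP; rewrite -subr_eq0; apply/eqP/f0; first exact: fsubB.
  by rewrite fS // e subrr.
have /choice[g gP] : forall y, exists x, forall x', x' \in S -> y = f x' -> x = x'.
  move=> y; have [[x [xS ->]]|no] := pselect (exists x, x \in S /\ y = f x).
    by exists x => x' x'S; apply: finj.
  by exists 0%R => x' x'S yE; case: no; exists x'.
have gf x : x \in S -> g (f x) = x by move=> xS; apply: gP.
have fSs : fsub (map f S).
  have [Su S0 SB] := Ss; split.
  - by rewrite map_inj_in_uniq // => x y xS yS; apply: finj.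
  - by rewrite -(addon0 Ss fS); apply: map_f.
  - by move=> _ _ /mapP[x xS ->] /mapP[y yS ->]; rewrite -fS //; apply/map_f/SB.
have -> : (holds phi (f \o v) -> holds phi v)
    = (holds phi (f \o v) -> holds phi (g \o (f \o v))).
  by congr (_ -> holds phi _); apply/funext => i /=; rewrite gf.
apply: (pp_preserved p_prime A'p fSs) => //.
- move=> _ _ /mapP[x xS ->] /mapP[y yS ->]; rewrite -fS // !gf //.
  exact: fsubB.
- by move=> _ m /mapP[x xS ->]; rewrite gf // => /fh; apply.
- by move=> i; apply: map_f.
Qed.

(** * Dimensions of elementary quotients *)

Section Subgroup.
Local Open Scope ring_scope.
Variables (A : zmodType) (G : set A) (Gs : is_subgroup G).

Lemma sg0 : G 0. Proof. by case: Gs. Qed.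

Lemma sgB x y : G x -> G y -> G (x - y). Proof. by case: Gs => _; apply. Qed.

Lemma sgN x : G x -> G (- x).
Proof. by move=> xG; rewrite -sub0r; apply: sgB => //; apply: sg0. Qed.

Lemma sgD x y : G x -> G y -> G (x + y).
Proof. by move=> xG yG; rewrite -[y]opprK; apply/sgB/sgN. Qed.

Lemma sgMn x n : G x -> G (x *+ n).
Proof. by move=> xG; elim: n => [|n IH]; [exact: sg0 | rewrite mulrS; apply: sgD]. Qed.

Lemma sgMz x n : G x -> G (x *~ n).
Proof.
by move=> xG; case: n => n; [exact: sgMn | rewrite NegzE mulrNz; apply/sgN/sgMn].
Qed.

Lemma sg_sum (I : eqType) (r : seq I) (f : I -> A) :
  (forall i, i \in r -> G (f i)) -> G (\sum_(i <- r) f i).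
Proof.
by move=> fG; rewrite big_seq; elim/big_rec: _ => [|i x /fG *]; [exact: sg0 | apply: sgD].
Qed.

End Subgroup.

Section Dimension.
Local Open Scope ring_scope.
Variables (p : nat) (p_prime : prime p).

(** Linear independence over the field with [p] elements in the quotient by [Q]; integer
    coefficients avoid forming the quotient. *)
Definition indep_mod (A : zmodType) (Q : set A) m (x : 'I_m -> A) : Prop :=
  forall c : 'I_m -> int, Q (\sum_i x i *~ c i) -> forall i, (p %| c i)%Z.

Definition dim_ge (A : zmodType) (P Q : set A) m : Prop :=
  exists x : 'I_m -> A, (forall i, P (x i)) /\ indep_mod Q x.

(** Numerator of the Ulm invariant of index [h]. Its denominator is taken to be all of [hge p h.+1]:
    combinations of socle elements stay in the socle, so independence is unaffected. *)
Definition ulm_num (A : zmodType) h : set A := [set x | hge p h x /\ x *+ p = 0].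

Definition infinite_height (A : zmodType) : set A := [set x | forall n, hge p n x].

Definition inf_socle (A : zmodType) i : set A :=
  [set x | x *+ p = 0 /\ exists2 w, infinite_height w & x = w *+ p ^ i].

Lemma hge_subgroup (A : zmodType) h : is_subgroup (@hge p A h).
Proof. by split=> [|x y]; [exact: hge0 | exact: hgeB]. Qed.

Lemma zero_subgroup (A : zmodType) : is_subgroup [set (0 : A)].
Proof. by split=> // x y /= -> ->; rewrite subrr. Qed.

Lemma sum_delta (A : zmodType) m (x : 'I_m -> A) j : \sum_i x i *~ (i == j)%:Z = x j.
Proof.
rewrite (bigD1 j) //= eqxx mulr1z big1 ?addr0 // => i /negbTE ->.
by rewrite mulr0z.
Qed.

Lemma prime_ndvd1 : ~~ (p %| (1 : int))%Z.
Proof. by rewrite dvdz1 absz_nat; case: p p_prime => [|[]]. Qed.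

Lemma indep_inj (A : zmodType) (Q : set A) m (x : 'I_m -> A) :
  Q 0 -> indep_mod Q x -> injective x.
Proof.
move=> Q0 xind i j xij; apply/eqP/negPn/negP => ij.
have /xind/(_ i) : Q (\sum_k x k *~ ((k == i)%:Z - (k == j)%:Z)).
  under eq_bigr do rewrite mulrzBr.
  by rewrite sumrB !sum_delta xij subrr.
by rewrite eqxx (negbTE ij) subr0; apply/negP/prime_ndvd1.
Qed.

Definition cons_fun (A : Type) m (x : A) (t : 'I_m -> A) : 'I_m.+1 -> A :=
  fun i => if unlift ord0 i is Some j then t j else x.

Lemma cons_fun_sum (A : zmodType) m (x : A) (t : 'I_m -> A) (c : 'I_m.+1 -> int) :
  \sum_i cons_fun x t i *~ c i = x *~ c ord0 + \sum_i t i *~ c (lift ord0 i).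
Proof.
rewrite big_ord_recl /cons_fun unlift_none; congr (_ + _).
by apply: eq_bigr => i _; rewrite liftK.
Qed.

Lemma cons_funP (A : Type) m (x : A) (t : 'I_m -> A) (P : A -> Prop) :
  P x -> (forall i, P (t i)) -> forall i, P (cons_fun x t i).
Proof. by move=> Px Pt i; rewrite /cons_fun; case: unlift. Qed.

Lemma indep_cons (A : zmodType) (Q : set A) m (x : A) (t : 'I_m -> A) : is_subgroup Q ->
    (forall c : 'I_m -> int, forall c0 : int,
       Q (x *~ c0 + \sum_i t i *~ c i) -> (p %| c0)%Z) ->
    Q (x *+ p) -> indep_mod Q t -> indep_mod Q (cons_fun x t).
Proof.
move=> Qs xt xp tind c; rewrite cons_fun_sum => Qc.
have c0 := xt _ _ Qc; have tc : Q (\sum_i t i *~ c (lift ord0 i)).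
  rewrite -[\sum_i _](addKr (x *~ c ord0)) addrC; apply: sgB => //.
  by case/dvdzP: c0 => q ->; rewrite mulrC mulrzA; apply: sgMz.
by move=> i; case: (unliftP ord0 i) => [j|] -> //; apply: tind tc j.
Qed.

(* [S] being finite, this compares dimensions without requiring that those of
   the ambient groups be finite. *)
Lemma dimension_gap (A A' : zmodType) (S : seq A) (f : A -> A') (T Q : set A) (P' Q' : set A') :
    fsub S -> addon S f -> is_subgroup Q -> is_subgroup Q' ->
    (forall y s, P' y -> s \in S -> Q' (y - f s) -> T s) ->
    (forall s, s \in S -> Q s -> Q' (f s)) ->
    (forall k (t : 'I_k -> A), (forall i, t i \in S) -> (forall i, T (t i)) ->
       indep_mod Q t -> dim_ge P' Q' k.+1) ->
  exists2 y, P' y & forall s, s \in S -> ~ Q' (y - f s).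
Proof.
move=> Ss fS Qs Q's TS QS long.
(* Take the largest [k] for which [S] has [k] elements of [T] independent modulo [Q]. If [k.+1]
   independent elements of [P'] were all congruent to images of elements of [S], those elements
   would contradict maximality. *)
pose R k := `[< exists t : 'I_k -> A,
  [/\ forall i, t i \in S, forall i, T (t i) & indep_mod Q t] >].
have R0 : exists k, R k.
  exists 0%N; apply/asboolP; exists (fun=> 0).
  by split=> [[]|[]|c _ []].
have Rle k : R k -> (k <= size S)%N.
  move=> /asboolP[t [tS _ /(indep_inj (sg0 Qs)) tinj]].
  rewrite -(size_enum_ord k) -(size_map t); apply: uniq_leq_size.
    by rewrite map_inj_uniq ?enum_uniq.
  by move=> _ /mapP[i _ ->].
case: (ex_maxnP R0 Rle) => k /asboolP[t [tS tT tind]] kmax.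
have [y [yP yind]] := long k t tS tT tind.
apply: contrapT => no.
have /choice[s sP] : forall i, exists s, s \in S /\ Q' (y i - f s).
  move=> i; apply: contrapT => nos; apply: no; exists (y i) => // s sS Qys.
  by apply: nos; exists s.
suff /kmax : R k.+1 by rewrite ltnn.
apply/asboolP; exists s; split=> [i|i|c Qc]; first by case: (sP i).
  by have [? ?] := sP i; apply: (TS (y i)).
apply: yind.
have sumS : \sum_i s i *~ c i \in S.
  by apply: fsub_sum => // i; apply: fsubMz => //; case: (sP i).
rewrite -[X in Q' X](subrK (f (\sum_i s i *~ c i))).
apply: sgD => //; last exact: QS.
rewrite (addon_sum Ss fS); last by move=> i; apply: fsubMz => //; case: (sP i).
rewrite -sumrB; apply: sg_sum => // i _; have [siS Qi] := sP i.
by rewrite (addonMz Ss fS) // -mulrzBl; apply: sgMz.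
Qed.

End Dimension.

(** * Height-preserving embeddings of finite subgroups *)

Section Embedding.
Local Open Scope ring_scope.
Variables (p : nat) (p_prime : prime p) (A A' : zmodType) (Ap : torsion p A).
Implicit Types (X S : seq A) (x : A).

Hypothesis inf_socleA : forall i m,
  dim_ge p (@inf_socle p A i) [set 0] m -> dim_ge p (@inf_socle p A' i) [set 0] m.

Definition inf_mul (B : zmodType) i (x : B) : Prop :=
  exists2 w, infinite_height p w & x = w *+ p ^ i.

Lemma inf_mul_subgroup (B : zmodType) i : is_subgroup (@inf_mul B i).
Proof.
split; first by exists 0; rewrite ?mul0rn // => n; apply: hge0.
by move=> _ _ [v vi ->] [w wi ->]; exists (v - w); rewrite ?mulrnBl // => n; apply: hgeB.
Qed.

(** A root [y1] of [f (x0 *+ p)] in [p^i W'] comes from the layer already embedded; the difficulty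
    is injectivity. If [y1 = f s], then [x0 - s] has order [p], and any element of the socle of
    [p^i W'] outside [f S] may serve as its image. *)
Lemma embed_step (Y : seq A) i S (f : A -> A') x0 :
    fsub Y -> (forall y, y \in Y -> infinite_height p y) ->
    fsub S -> addon S f -> {subset S <= Y} ->
    (forall x, x \in S -> f x = 0 -> x = 0) ->
    (forall x, x \in Y -> (exists2 w, w \in Y & x = w *+ p ^ i.+1) ->
       x \in S /\ inf_mul i.+1 (f x)) ->
    (exists2 w, w \in Y & x0 = w *+ p ^ i) -> x0 \notin S ->
    {in S, forall x, exists2 w, w \in Y & x = w *+ p ^ i} ->
  exists (x : A) (y : A'),
    [/\ exists2 w, w \in Y & x = w *+ p ^ i, x \notin S /\ x *+ p \in S,
        y *+ p = f (x *+ p), inf_mul i y & forall s, s \in S -> y <> f s].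
Proof.
move=> Ys Yinf Ss fS SY f0 fi [w0 w0Y x0E] x0S Si.
have px0Y : x0 *+ p \in Y by rewrite x0E; do 2! apply: fsubMn => //.
have px0w : exists2 w, w \in Y & x0 *+ p = w *+ p ^ i.+1.
  by exists w0 => //; rewrite x0E -mulrnA -expnSr.
have [px0S [w' w'inf fpx0]] := fi _ px0Y px0w.
pose y1 := w' *+ p ^ i.
have py1 : y1 *+ p = f (x0 *+ p) by rewrite fpx0 -mulrnA -expnSr.
have [[s [sS y1s]]|no] := pselect (exists s, s \in S /\ y1 = f s); last first.
  exists x0, y1; split=> //; [by exists w0 | by exists w' |].
  by move=> s sS y1s; apply: no; exists s.
pose x := x0 - s.
have px : x *+ p = 0.
  apply: f0; first by rewrite mulrnBl; apply: fsubB => //; apply: fsubMn.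
  rewrite mulrnBl fS //; last exact: fsubMn.
  by rewrite (addonMn Ss fS p sS) -py1 y1s subrr.
have xS : x \notin S.
  by apply/negP => /(fsubD Ss)/(_ sS); rewrite subrK (negbTE x0S).
have xw : exists2 w, w \in Y & x = w *+ p ^ i.
  have [v vY sE] := Si s sS; exists (w0 - v); first exact: fsubB.
  by rewrite /x x0E sE mulrnBl.
have [y [py0 yinf] yS] : exists2 y : A', inf_socle p i y & forall s, s \in S -> ~ y - f s = 0.
  apply: (@dimension_gap p p_prime _ _ S f [set s | s *+ p = 0] [set 0] _ [set 0]) => //.
  - exact: zero_subgroup.
  - exact: zero_subgroup.
  - move=> y t [py _] tS /= /subr0_eq ytE; apply: f0; first exact: fsubMn.
    by rewrite (addonMn Ss fS) // -ytE.
  - by move=> _ _ ->; rewrite /= (addon0 Ss fS).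
  (* Being outside [S], [x] adds one dimension to the socle elements taken in [S]. *)
  - move=> k t tS tp tind; apply: inf_socleA; exists (cons_fun x t); split.
      apply: cons_funP => [|j]; split=> //.
        by have [v vY xE] := xw; exists v => //; apply: Yinf.
        exact: tp.
      by have [v vY tE] := Si _ (tS j); exists v => //; apply: Yinf.
    apply: indep_cons => //; first exact: zero_subgroup.
    move=> c c0 /= e; apply: (coef_dvd p_prime Ss xS); first by rewrite px fsub0.
    rewrite -[x *~ c0](addrK (\sum_i t i *~ c i)) e sub0r; apply: fsubN => //.
    by apply: fsub_sum => // j; apply: fsubMz.
exists x, y; split=> //.
- by split=> //; rewrite px fsub0.
- by rewrite px (addon0 Ss fS).
- by move=> t tS yt; apply: (yS t) => //; rewrite yt subrr.
Qed.

Lemma embed_layer (Y : seq A) i : fsub Y -> (forall y, y \in Y -> infinite_height p y) ->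
  forall N S (f : A -> A'), (size Y <= size S + N)%N ->
    fsub S -> addon S f -> {subset S <= Y} ->
    (forall x, x \in S -> f x = 0 -> x = 0) ->
    (forall x, x \in Y -> (exists2 w, w \in Y & x = w *+ p ^ i.+1) ->
       x \in S /\ inf_mul i.+1 (f x)) ->
    {in S, forall x, exists2 w, w \in Y & x = w *+ p ^ i} ->
    {in S, forall x, inf_mul i (f x)} ->
  exists S' (g : A -> A'), [/\ fsub S', addon S' g,
    forall x, x \in S' -> g x = 0 -> x = 0,
    forall x, x \in S' <-> exists2 w, w \in Y & x = w *+ p ^ i
    & {in S', forall x, inf_mul i (g x)}].
Proof.
move=> Ys Yinf; elim=> [|N IH] S f sz Ss fS SY f0 fi Si Sinf.
  exists S, f; split=> // x; split=> [/Si //|[w wY ->]].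
  rewrite addn0 in sz; have [Su _ _] := Ss.
  by have [_ ->] := uniq_min_size Su SY sz; apply: fsubMn.
have [YS|] := pselect (forall x, (exists2 w, w \in Y & x = w *+ p ^ i) -> x \in S).
  by exists S, f; split=> // x; split=> [/Si //|/YS].
move=> /existsNP[x0 /not_implyP[x0Y /negP x0S]].
have [x [y [[w wY xE] [xS pxS] ypx yinf yS]]] :=
  embed_step Ys Yinf Ss fS SY f0 fi x0Y x0S Si.
have [S' [g [[S's SS' xS' gx] gS' gf S'P S'Q]]] := extend_addon p_prime Ap Ss fS xS pxS ypx.
have S'i : {in S', forall z, exists2 w, w \in Y & z = w *+ p ^ i}.
  move=> _ /S'P[s [n [sS ->]]]; have [v vY ->] := Si s sS.
  exists (v + w *~ n); first by apply: fsubD => //; apply: fsubMz.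
  by rewrite mulrnDl xE !pmulrn mulrzAC.
apply: (IH S' g) => //.
- by apply: leq_trans sz _; rewrite addnS -addSn leq_add2r; apply: size_adjoin xS xS'.
- by move=> z /S'i[v vY ->]; apply: fsubMn.
- move=> z zS' gz; have [zS|[m [t [pm tS zm gzm]]]] := S'Q z zS'.
    by apply: f0; rewrite -?gf.
  (* On the new coset the image vanishes only if [y = f (- t)], which the choice of [y] excludes. *)
  have := yS (- t); case; first exact: fsubN.
  rewrite (addonN Ss fS) //; apply/eqP; rewrite -subr_eq0 opprK -gzm gz.
  by rewrite mul0rz.
- by move=> z zY zi; have [zS fz] := fi z zY zi; rewrite gf //; split=> //; apply: SS'.
- move=> _ /S'P[s [n [sS ->]]].
  rewrite (addonD S's gS' (SS' s sS) (fsubMz n S's xS')) (addonMz S's gS' n xS') gx gf //.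
  have igs := @inf_mul_subgroup A' i; apply: (sgD igs); first exact: Sinf.
  exact: (sgMz igs).
Qed.

Lemma common_exponent (Y : seq A) : exists e, {in Y, forall y, y *+ p ^ e = 0}.
Proof.
elim: Y => [|y Y [e Ye]]; first by exists 0%N.
have [k yk] := Ap y; exists (k + e)%N => z; rewrite inE expnD => /orP[/eqP ->|/Ye ze].
  by rewrite mulrnA yk mul0rn.
by rewrite mulnC mulrnA ze mul0rn.
Qed.

(** Layers are taken from [p^e Y = 0] down to [Y] itself, each mapped into [p^i W'] so that the next
    one finds its roots. *)
Lemma embed_infinite_height (Y : seq A) :
    fsub Y -> (forall y, y \in Y -> infinite_height p y) ->
  exists f : A -> A', [/\ addon Y f, forall x, x \in Y -> f x = 0 -> x = 0
    & forall x, x \in Y -> infinite_height p (f x)].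
Proof.
move=> Ys Yinf; have [e Ye] := common_exponent Y.
have embed : forall k, (k <= e)%N -> exists S' (g : A -> A'), [/\ fsub S', addon S' g,
    forall x, x \in S' -> g x = 0 -> x = 0,
    forall x, x \in S' <-> exists2 w, w \in Y & x = w *+ p ^ (e - k)
    & {in S', forall x, inf_mul (e - k) (g x)}].
  elim=> [_|k IH ke].
    rewrite subn0; exists [:: 0], (fun=> 0); split=> //.
    - exact: fsub_zero.
    - by move=> x y _ _; rewrite subr0.
    - by move=> x; rewrite inE => /eqP.
    - move=> x; rewrite inE; split=> [/eqP ->|[w wY ->]]; last by rewrite Ye.
      by exists 0; rewrite ?mul0rn //; apply: fsub0.
    - by move=> x _; apply: sg0; apply: inf_mul_subgroup.
  have [S [f [Ss fS f0 SE fi]]] := IH (ltnW ke).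
  have ekE : (e - k = (e - k.+1).+1)%N by rewrite subnSK.
  rewrite ekE in SE fi.
  apply: (embed_layer Ys Yinf (N := size Y) (S := S) (f := f)) => //.
  - exact: leq_addl.
  - by move=> x /SE[w wY ->]; apply: fsubMn.
  - by move=> x xY xi; split; [apply/SE | apply/fi/SE].
  - move=> x /SE[w wY ->]; exists (w *+ p); first exact: fsubMn.
    by rewrite -mulrnA -expnS.
  - move=> x /fi[w wi ->]; exists (w *+ p); last by rewrite -mulrnA -expnS.
    by move=> n; apply: hge_le (hgeMp (wi n)).
have [S [f [Ss fS f0 SE fi]]] := embed e (leqnn e).
rewrite subnn expn0 in SE fi.
have YS x : x \in Y -> x \in S by move=> xY; apply/SE; exists x.
exists f; split=> [x y /YS xS /YS yS|x /YS|x /YS /fi[w wi ->]]; [exact: fS | exact: f0 |].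
by rewrite expn0 mulr1n.
Qed.

Hypothesis ulm_numA : forall h m,
  dim_ge p (@ulm_num p A h) (@hge p A h.+1) m -> dim_ge p (@ulm_num p A' h) (@hge p A' h.+1) m.

(* The step of Kaplansky's proof of Ulm's theorem, for finite heights. *)
Lemma ulm_step S (f : A -> A') x0 h : fsub S -> height_embedding p S f ->
    x0 \notin S -> x0 *+ p \in S -> hge p h x0 ->
    (forall s, s \in S -> ~ hge p h.+1 (x0 + s)) ->
  exists s (y : A'), [/\ s \in S, hge p h (x0 + s), y *+ p = f ((x0 + s) *+ p), hge p h y
    & forall t, t \in S -> ~ hge p h.+1 (y + f t)].
Proof.
move=> Ss [fS f0 fh] x0S px0S x0h x0max.
have pxS s : s \in S -> (x0 + s) *+ p \in S.
  by move=> sS; rewrite mulrnDl; apply: fsubD => //; apply: fsubMn.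
(* If no element of height [h] in the coset gains two units under multiplication by [p], any root
   [y] of height [h] works: were [y + f t] of height [h.+1], then [(x0 + t) *+ p] would have height
   [h.+2]. *)
have [[s [sS xh pxh]]|no] := pselect (exists s,
    [/\ s \in S, hge p h (x0 + s) & hge p h.+2 ((x0 + s) *+ p)]); last first.
  have : hge p h.+1 (f (x0 *+ p)) by apply/fh/hgeMp.
  move=> /hge_divp[y yh ypx]; exists 0, y; rewrite addr0; split=> //; first exact: fsub0.
  move=> t tS yt; apply: no; exists t.
  have th : hge p h t.
    by apply/fh => //; rewrite -[f t](addKr y) addrC; apply: hgeB => //; apply: hge_le yt.
  split=> //; first exact: hgeD.
  apply/fh; first exact: pxS.
  rewrite mulrnDl (addonD Ss fS px0S (fsubMn p Ss tS)) (addonMn Ss fS p tS) ypx -mulrnDl.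
  exact: hgeMp.
set x := x0 + s in xh pxh.
have xmax t : t \in S -> ~ hge p h.+1 (x + t).
  by move=> tS; rewrite -addrA; apply: x0max; apply: fsubD.
have [w wh pxw] := hge_divp pxh.
have : hge p h.+2 (f (x *+ p)) by apply/fh => //; apply: pxS.
move=> /hge_divp[w' w'h fpxw'].
(* These are the elements of height [h] that differ from a socle element by an element of height
   [h.+1], as [x] does through [w]. *)
pose T : set A := [set t | hge p h t /\ hge p h.+2 (t *+ p)].
have [y [yh py] yS] : exists2 y : A', ulm_num p h y & forall s, s \in S -> ~ hge p h.+1 (y - f s).
  apply: (@dimension_gap p p_prime A A' S f T (@hge p A h.+1)
    (@ulm_num p A' h) (@hge p A' h.+1)) => //.
  - exact: hge_subgroup.
  - exact: hge_subgroup.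
  - move=> y t [yh py] tS yt; split.
      apply/fh => //; rewrite -[f t](subKr y); apply: hgeB => //.
      exact: hge_le yt.
    apply/fh; first exact: fsubMn.
    have /hgeN := hgeMp yt; rewrite mulrnBl py sub0r opprK.
    by rewrite (addonMn Ss fS).
  - by move=> t tS /fh; apply.
  - move=> k t tS tT tind; apply: ulm_numA.
    (* Subtracting [v i] moves [t i] into the socle without changing its class modulo height [h.+1].
       Then [x - w] is independent of these since no [x + t] has height [h.+1]. *)
    have /choice[v vP] : forall i, exists v, hge p h.+1 v /\ t i *+ p = v *+ p.
      by move=> i; have [_ /hge_divp[v vh tv]] := tT i; exists v.
    have sumh (c : 'I_k -> int) : hge p h.+1 (\sum_i v i *~ c i).
      by apply: hge_sum => i; apply: hgeMz; case: (vP i).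
    have sumE (c : 'I_k -> int) :
        \sum_i (t i - v i) *~ c i = \sum_i t i *~ c i - \sum_i v i *~ c i.
      by rewrite -sumrB; apply: eq_bigr => i _; rewrite mulrzBl.
    have xwp : (x - w) *+ p = 0 by rewrite mulrnBl pxw subrr.
    exists (cons_fun (x - w) (fun i => t i - v i)); split.
      apply: cons_funP => [|i]; split=> //.
      + by apply: hgeB => //; apply: hge_le wh.
      + by have [vh tv] := vP i; have [th _] := tT i; apply: hgeB => //; apply: hge_le vh.
      + by have [_ tv] := vP i; rewrite mulrnBl tv subrr.
    apply: indep_cons => //; first exact: hge_subgroup.
    + move=> c c0 e; apply/negPn/negP => /(bezout_prime p_prime)[m [q mq]].
      apply: (xmax (\sum_i t i *~ c i *~ m)).
        by apply: fsub_sum => // i; do 2! apply: fsubMz => //.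
      have -> : x + \sum_i t i *~ c i *~ m
          = ((x - w) *~ c0 + \sum_i (t i - v i) *~ c i) *~ m
            + (w + (\sum_i v i *~ c i) *~ m).
        rewrite sumE [(_ + _) *~ m]mulrzDl -mulrzA [c0 * m]mulrC.
        have -> : m * c0 = 1 - q * p%:Z by rewrite -mq addrK.
        rewrite mulrzBr mulr1z mulrC mulrzA -pmulrn xwp mul0rz subr0.
        rewrite mulrzBl addrACA subrK subrK; congr (_ + _).
        by rewrite mulrz_suml.
      apply: hgeD; first exact: hgeMz.
      by apply: hgeD => //; apply: hgeMz.
    + by rewrite xwp; apply: hge0.
    + move=> c; rewrite sumE => e; apply: tind.
      by rewrite -[\sum_i _](subrK (\sum_i v i *~ c i)); apply: hgeD.
(* [w'] is a root of too large a height; the socle element [y] corrects its height and leaves its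
   [p]-multiple unchanged. *)
exists s, (w' + y); split=> //.
- by rewrite mulrnDl py addr0.
- by apply: hgeD => //; apply: hge_le w'h.
- move=> t tS wyt; apply: (yS (- t)); first exact: fsubN.
  rewrite (addonN Ss fS) // opprK -[y + f t](addKr w') addrC addrA.
  exact: hgeB.
Qed.

Lemma max_height_coset S x : (forall s, s \in S -> ~ infinite_height p (x + s)) ->
  exists h, forall s, s \in S -> ~ hge p h (x + s).
Proof.
elim: S => [|s S IH] fin; first by exists 0%N.
have [|h hP] := IH; first by move=> t tS; apply: fin; rewrite inE tS orbT.
have /existsNP[k kP] := fin s (mem_head _ _).
exists (maxn h k) => t; rewrite inE => /orP[/eqP ->|tS] xt.
  by apply: kP; apply: hge_le xt; apply: leq_maxr.
by apply: (hP t tS); apply: hge_le xt; apply: leq_maxl.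
Qed.

(** As [S] holds all elements of infinite height of [X], a coset outside [S] has bounded heights and
    thus a representative of maximal height. *)
Lemma extend_embedding X N : fsub X -> forall S (f : A -> A'),
    fsub S -> height_embedding p S f -> {subset S <= X} -> (size X <= size S + N)%N ->
    (forall x, x \in X -> infinite_height p x -> x \in S) ->
  exists g : A -> A', height_embedding p X g.
Proof.
move=> Xs; elim: N => [|N IH] S f Ss fhe SX sz Xinf.
  exists f; rewrite addn0 in sz.
  have [Su _ _] := Ss; have [_ SXe] := uniq_min_size Su SX sz.
  by case: fhe => fS f0 fh; split=> [x y|x|x n]; rewrite -!SXe; auto.
have [XS|/existsNP[x0 /not_implyP[x0X /negP x0S]]] := pselect {subset X <= S}.
  exists f; case: fhe => fS f0 fh; split=> [|x /XS|x n /XS]; auto.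
  exact: (addon_sub fS).
have [k []] := step_below Ap Ss x0S.
have : x0 *+ k \in X by apply: fsubMn.
move: {x0 x0X x0S} (x0 *+ k) => x1 x1X x1S px1S.
have [|H HP] := @max_height_coset S x1.
  move=> s sS /Xinf xsS; case/negP: x1S; rewrite -(fsubDl _ Ss sS) addrC.
  by apply: xsS; apply: fsubD => //; apply: SX.
pose Q h := `[< forall s, s \in S -> ~ hge p h (x1 + s) >].
have exQ : exists h, Q h by exists H; apply/asboolP.
case: (ex_minnP exQ) => -[/asboolP/(_ 0 (fsub0 Ss)) []|h /asboolP hP hmin].
  exact: hge0n.
have [s0 s0S x0h] : exists2 s, s \in S & hge p h (x1 + s).
  apply: contrapT => no; suff /hmin : Q h by rewrite ltnn.
  by apply/asboolP => s sS xs; apply: no; exists s.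
have [|||s [y [sS]]] := @ulm_step S f (x1 + s0) h Ss fhe _ _ x0h.
- by rewrite addrC fsubDl.
- by rewrite mulrnDl; apply: fsubD => //; apply: fsubMn.
- by move=> s sS; rewrite -addrA; apply: hP; apply: fsubD.
rewrite -addrA; set x := x1 + (s0 + s) => xh ypx yh ymax.
have xmax t : t \in S -> ~ hge p h.+1 (x + t).
  by move=> tS; rewrite -addrA; apply: hP; do 2! apply: fsubD => //.
have xS : x \notin S by rewrite /x addrC fsubDl //; apply: fsubD.
have xX : x \in X by apply: fsubD => //; apply/SX/fsubD.
have pxS : x *+ p \in S by rewrite mulrnDl; apply: fsubD => //; apply/fsubMn/fsubD.
have [fS f0 fh] := fhe.
have [S' [g [[S's SS' xS' gx] gS' gf S'P S'Q]]] := extend_addon p_prime Ap Ss fS xS pxS ypx.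
(* [x] and [y] have maximal height [h] in their cosets, so the height of [x + t] is the minimum of
   [h] and that of [t], and likewise for [y + f t]. *)
have cosetP t n : t \in S -> hge p n (x + t) <-> hge p n (y + f t).
  have small (B : zmodType) (u v : B) : hge p h u -> ~ hge p h.+1 (u + v) ->
      hge p n (u + v) -> hge p n u /\ hge p n v.
    move=> uh uv uvn; have nh : (n <= h)%N.
      by rewrite leqNgt; apply/negP => /hge_le/(_ uvn).
    have un := hge_le nh uh; split=> //.
    by rewrite -[v](addKr u) addrC; apply: hgeB.
  move=> tS; split=> [/(small _ _ _ xh (xmax t tS))|/(small _ _ _ yh (ymax t tS))].
    move=> [xn /fh ftn]; apply: hgeD; last exact: ftn.
    apply: hge_le yh; rewrite leqNgt; apply/negP => /hge_le/(_ xn) xh'.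
    by apply: (xmax 0); rewrite ?addr0 ?fsub0.
  move=> [yn ftn]; apply: hgeD; last exact/fh.
  apply: hge_le xh; rewrite leqNgt; apply/negP => /hge_le/(_ yn) yh'.
  by apply: (ymax 0); rewrite ?(addon0 Ss fS) ?addr0 ?fsub0.
apply: (IH S' g) => //.
- split=> // [z zS' gz|z n zS'].
    have [zS|[m [t [pm tS zm gzm]]]] := S'Q z zS'; first by apply: f0; rewrite -?gf.
    (* Zero has every height, so [ymax] also keeps the kernel trivial. *)
    by case: (ymax t tS); rewrite -gzm gz mul0rz; apply: hge0.
  have [zS|[m [t [pm tS zm gzm]]]] := S'Q z zS'; first by rewrite gf //; apply: fh.
  split=> [zn|gzn]; apply: (hge_unit p_prime pm).
    by rewrite gzm; apply/cosetP; rewrite // -zm; apply: hgeMz.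
  by rewrite zm; apply/cosetP; rewrite // -gzm; apply: hgeMz.
- move=> _ /S'P[t [n [tS ->]]]; apply: fsubD; [by []|exact: SX|exact: fsubMz].
- by apply: leq_trans sz _; rewrite addnS -addSn leq_add2r; apply: size_adjoin xS xS'.
- by move=> z zX zinf; apply/SS'/Xinf.
Qed.

Lemma pp_realizes_of_invariants : torsion p A' -> pp_realizes A A'.
Proof.
move=> A'p L; have [X [Xs LX]] := fsub_gen p_prime Ap L.
pose Y := [seq x <- X | `[< infinite_height p x >]].
have YP x : x \in Y <-> x \in X /\ infinite_height p x.
  by rewrite mem_filter; split=> [/andP[/asboolP]|[xX xi]] //; rewrite xX andbT; apply/asboolP.
have Ys : fsub Y.
  split.
  - by apply: filter_uniq; case: Xs.
  - by apply/YP; split; [exact: fsub0 | move=> n; apply: hge0].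
  - move=> x y /YP[xX xi] /YP[yX yi]; apply/YP; split; first exact: fsubB.
    by move=> n; apply: hgeB.
have [f [fY f0 fi]] := embed_infinite_height Ys (fun y yY => proj2 (proj1 (YP y) yY)).
have fhe : height_embedding p Y f.
  split=> // x n xY; split=> _; [exact: fi | by case/YP: xY].
have [g gP] : exists g : A -> A', height_embedding p X g.
  apply: (extend_embedding Xs Ys fhe (N := size X)); rewrite ?leq_addl //.
    by move=> x /YP[].
  by move=> x xX xi; apply/YP.
exists g => n phi v ppphi vL.
by apply: (height_embedding_pp p_prime Ap A'p Xs gP) => // i; apply: LX.
Qed.

End Embedding.

(** * Isotypic groups have the same dimensions *)

Section Types.
Local Open Scope ring_scope.

Lemma tp_subset_realizes (A A' : zmodType) : tp A `<=` tp A' ->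
  forall n (a : 'I_n -> A), exists b : 'I_n -> A', forall f, holds f a <-> holds f b.
Proof.
move=> AA' n a; have [m [g e]] : tp A' (existT _ n (tp_tuple [tuple a i | i < n])).
  by apply: AA'; exists n, [tuple a i | i < n].
have nm : n = m by have := congr1 (@projT1 _ _) e.
subst m; have := Eqdep_dec.inj_pair2_eq_dec _ (@eq_comparable nat) _ _ _ _ e.
have -> : tp_tuple [tuple a i | i < n] = [set f | holds f a].
  rewrite /tp_tuple; congr mkset; apply/funext => f; congr holds.
  by apply/funext => i; rewrite tnth_mktuple.
by move=> E; exists (tnth g) => f; have := congr1 (@^~ f) E => /= ->.
Qed.

Lemma tp_subset_of_realizes (A A' : zmodType) :
    (forall n (a : 'I_n -> A), exists b : 'I_n -> A', forall f, holds f a <-> holds f b) ->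
  tp A `<=` tp A'.
Proof.
move=> AA' _ [n [a ->]]; have [b ab] := AA' n (tnth a).
exists n, [tuple b i | i < n]; congr existT; apply/seteqP.
have -> : tp_tuple [tuple b i | i < n] = [set f | holds f b].
  rewrite /tp_tuple; congr mkset; apply/funext => f; congr holds.
  by apply/funext => i; rewrite tnth_mktuple.
by split=> f /ab.
Qed.

Definition mul_term n (t : term n) (k : nat) : term n := iter k (Op t) (Unit n).

Definition mulz_term n (t : term n) (k : int) : term n :=
  match k with Posz k => mul_term t k | Negz k => Defs.Inv (mul_term t k.+1) end.

Definition lin_term n m (s : 'I_n -> term m) (c : 'I_n -> int) : term m :=
  foldr (fun i t => Op (mulz_term (s i) (c i)) t) (Unit m) (enum 'I_n).

Definition height_formula (p n h : nat) (c : 'I_n -> int) : formula n :=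
  Exists (Eq (lin_term (fun i => Var (lift ord_max i)) c)
             (mul_term (Var ord_max) (p ^ h))).

Definition zero_formula n (c : 'I_n -> int) : formula n :=
  Eq (lin_term (@Var n) c) (Unit n).

Section Evaluation.
Variable A : zmodType.

Lemma eval_mul n (v : 'I_n -> A) t k : eval v (mul_term t k) = eval v t *+ k.
Proof. by elim: k => //= k ->; rewrite mulrS. Qed.

Lemma eval_mulz n (v : 'I_n -> A) t k : eval v (mulz_term t k) = eval v t *~ k.
Proof.
case: k => k; first exact: eval_mul.
by rewrite NegzE mulrNz /mulz_term /= -/(mul_term t k) eval_mul -mulrS.
Qed.

Lemma eval_lin n m (v : 'I_m -> A) (s : 'I_n -> term m) c :
  eval v (lin_term s c) = \sum_i eval v (s i) *~ c i.
Proof.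
rewrite /lin_term -big_enum /=; elim: (enum _) => [|i r IH] /=; first by rewrite big_nil.
by rewrite big_cons IH eval_mulz.
Qed.

Lemma holds_height p n h (c : 'I_n -> int) (a : 'I_n -> A) :
  holds (height_formula p h c) a <-> hge p h (\sum_i a i *~ c i).
Proof.
have E x : \sum_i eval (extend a x) (Var (lift ord_max i)) *~ c i = \sum_i a i *~ c i.
  by apply: eq_bigr => i _; rewrite /= /extend liftK.
split=> -[x]; rewrite /= => e; exists x; move: e;
  by rewrite eval_lin eval_mul E /= /extend unlift_none.
Qed.

Lemma holds_zero n (c : 'I_n -> int) (a : 'I_n -> A) :
  holds (zero_formula c) a <-> \sum_i a i *~ c i = 0.
Proof. by rewrite /= eval_lin. Qed.

End Evaluation.

Variables (p : nat) (p_prime : prime p).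

Lemma realizes_ulm_num (A A' : zmodType) :
    (forall n (a : 'I_n -> A), exists b : 'I_n -> A', forall f, holds f a <-> holds f b) ->
  forall h m, dim_ge p (@ulm_num p A h) (@hge p A h.+1) m ->
    dim_ge p (@ulm_num p A' h) (@hge p A' h.+1) m.
Proof.
move=> AA' h m [x [xP xind]]; have [y xy] := AA' m x.
have hgeE k c : hge p k (\sum_i x i *~ c i) <-> hge p k (\sum_i y i *~ c i).
  by rewrite -!holds_height.
have zeroE c : \sum_i x i *~ c i = 0 <-> \sum_i y i *~ c i = 0.
  by rewrite -!holds_zero.
exists y; split=> [i|c yc]; last by apply: xind; apply/hgeE.
have [xh xp] := xP i; split.
  by rewrite -(sum_delta y i); apply/hgeE; rewrite sum_delta.
rewrite -(sum_delta y i) pmulrn mulrz_suml; under eq_bigr do rewrite -mulrzA.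
by apply/zeroE; under eq_bigr do rewrite mulrzA; rewrite -mulrz_suml sum_delta.
Qed.

(** The transferred tuple consists of the roots [w], not of the socle elements: infinite height of
    [w] is a set of formulas in its type, whereas the existence of such a [w] is an infinite
    conjunction under a quantifier. *)
Lemma realizes_inf_socle (A A' : zmodType) :
    (forall n (a : 'I_n -> A), exists b : 'I_n -> A', forall f, holds f a <-> holds f b) ->
  forall i m, dim_ge p (@inf_socle p A i) [set 0] m ->
    dim_ge p (@inf_socle p A' i) [set 0] m.
Proof.
move=> AA' i m [x [xP xind]].
have /choice[w wP] : forall j, exists w, infinite_height p w /\ x j = w *+ p ^ i.
  by move=> j; have [_ [w wi xE]] := xP j; exists w.
have [y wy] := AA' m w.
have hgeE k c : hge p k (\sum_i w i *~ c i) <-> hge p k (\sum_i y i *~ c i).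
  by rewrite -!holds_height.
have zeroE c : \sum_i w i *~ c i = 0 <-> \sum_i y i *~ c i = 0.
  by rewrite -!holds_zero.
have mulE (B : zmodType) (u : 'I_m -> B) c k :
    (\sum_i u i *~ c i) *+ k = \sum_i u i *~ (c i * k%:Z).
  by rewrite pmulrn mulrz_suml; apply: eq_bigr => j _; rewrite mulrzA.
exists (fun j => y j *+ p ^ i); split=> [j|c /= yc].
  have [xp _] := xP j; have [wi xE] := wP j; split.
    rewrite -(sum_delta y j) !mulE; apply/zeroE.
    by rewrite -!mulE sum_delta -xE.
  exists (y j) => // n; rewrite -(sum_delta y j); apply/hgeE.
  by rewrite sum_delta; apply: wi.
have swap (B : zmodType) (u : 'I_m -> B) :
    \sum_j u j *+ p ^ i *~ c j = \sum_j u j *~ (c j * (p ^ i)%N%:Z).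
  by apply: eq_bigr => j _; rewrite mulrC mulrzA.
apply: xind => /=; rewrite (eq_bigr (fun j => w j *+ p ^ i *~ c j)); last first.
  by move=> j _; case: (wP j) => _ ->.
by rewrite swap; apply/zeroE; rewrite -swap.
Qed.

Theorem tp_invariants (A A' : zmodType) : torsion p A -> torsion p A' ->
  tp A = tp A' <->
    (forall h m, dim_ge p (@ulm_num p A h) (@hge p A h.+1) m <->
       dim_ge p (@ulm_num p A' h) (@hge p A' h.+1) m) /\
    (forall i m, dim_ge p (@inf_socle p A i) [set 0] m <->
       dim_ge p (@inf_socle p A' i) [set 0] m).
Proof.
move=> Ap A'p; split=> [AA'|[ulmE infE]].
  have R1 := @tp_subset_realizes A A'; have R2 := @tp_subset_realizes A' A.
  rewrite AA' in R1 R2; have {}R1 := R1 (fun _ x => x); have {}R2 := R2 (fun _ x => x).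
  split=> k m; split; by [apply: realizes_ulm_num | apply: realizes_inf_socle].
have AA' : pp_realizes A A'.
  by apply: (pp_realizes_of_invariants p_prime Ap) => // k m; [rewrite infE | rewrite ulmE].
have A'A : pp_realizes A' A.
  by apply: (pp_realizes_of_invariants p_prime A'p) => // k m; [rewrite -infE | rewrite -ulmE].
have realize (G H : zmodType) : torsion p G -> torsion p H ->
    pp_realizes G H -> pp_realizes H G -> tp G `<=` tp H.
  move=> Gp Hp GH HG; apply: tp_subset_of_realizes => n a.
  have [g gP] := GH (codom a); exists (g \o a) => f.
  have [I [S [Spp]]] := pp_elimination p_prime Gp Hp GH HG f; apply=> i.
  by apply: gP => // j; apply: codom_f.
by apply/seteqP; split; apply: realize.
Qed.

End Types.

(** * Cardinals and bases *)

Section Cardinals.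

Lemma card_geP (T : Type) (X : set T) m :
  `I_m #<= X <-> exists f : 'I_m -> T, injective f /\ forall i, X (f i).
Proof.
rewrite (card_le_eql card_II); split=> [/card_leP[f]|[f [finj Xf]]].
  exists (fun i => val (f (SigSub (mem_set (I : [set: 'I_m] i))))); split=> [i j /val_inj|i].
    by move=> /(inj (mem_set I) (mem_set I)) [].
  by apply: set_mem; apply: valP.
have [g] : $|{injfun [set: 'I_m] >-> X}|.
  by apply/injfunPex; exists f => // i j _ _; apply: finj.
exact: inj_card_le.
Qed.

Lemma infinite_card_ge T (X : set T) : infinite_set X <-> forall m, `I_m #<= X.
Proof.
split=> [/infiniteP natX m|Xm [n Xn]].
  by apply: card_le_trans natX; apply: subset_card_le.
by have := Xm n.+1; rewrite (card_le_eqr Xn) card_le_II ltnn.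
Qed.

(** In this form cardinals are compared with [dim_ge]. *)
Lemma card_approxP T U (X : set T) (Y : set U) :
  card_approx X Y <-> forall m, `I_m #<= X <-> `I_m #<= Y.
Proof.
split=> [[[_ _ XY] m|[/infinite_card_ge Xinf /infinite_card_ge Yinf] m]|XY].
- by rewrite (card_le_eqr XY).
- by split=> _.
have [Xfin|Xinf] := pselect (finite_set X); last first.
  have Xm := (infinite_card_ge X).1 Xinf.
  by right; split=> //; apply/infinite_card_ge => m; apply/XY/Xm.
have [Yfin|/infinite_card_ge Ym] := pselect (finite_set Y); last first.
  by case: ((infinite_card_ge X).2 (fun m => (XY m).2 (Ym m))).
left; split=> //; have [n Xn] := Xfin; have [k Yk] := Yfin.
apply/(card_eq_trans Xn)/card_esym/(card_eq_trans Yk)/card_eq_II/eqP.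
have := (XY k).2; have := (XY n).1.
rewrite !(card_le_eqr Xn) !(card_le_eqr Yk) !card_le_II !leqnn eqn_leq.
by move=> -> // ->.
Qed.

Definition sum_set (T U : Type) (X : set T) (Y : set U) : set (T + U) :=
  [set u | match u with inl x => X x | inr y => Y y end].

(* The subtraction is truncated: both sides hold when [q <= n]. *)
Lemma sum_set_card_ge T U (X : set T) (Y : set U) n q : X #= `I_n ->
  `I_q #<= sum_set X Y <-> `I_(q - n) #<= Y.
Proof.
move=> Xn; split=> [/card_geP[f [finj fXY]]|].
  pose isl (u : T + U) := if u is inl _ then true else false.
  (* At most [n] indices go to [X], hence at least [q - n] go to [Y]. *)
  pose L := [set i | isl (f i)]%SET.
  have Ln : (#|L| <= n)%N.
    suff : `I_#|L| #<= X by rewrite (card_le_eqr Xn) card_le_II.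
    apply/card_geP.
    have /choice[g gP] : forall i : 'I_#|L|, exists x, f (enum_val i) = inl x.
      by move=> i; have := enum_valP i; rewrite inE; case: (f _) => // x; exists x.
    exists g; split=> [i j gij|i].
      by apply/enum_val_inj/finj; rewrite !gP gij.
    by have := fXY (enum_val i); rewrite gP.
  have qL : (q - n <= #|~: L|)%N.
    by rewrite cardsCs finset.setCK card_ord leq_sub2l.
  apply/card_geP.
  have /choice[g gP] : forall i : 'I_#|~: L|, exists y, f (enum_val i) = inr y.
    by move=> i; have := enum_valP i; rewrite !inE; case: (f _) => // y; exists y.
  exists (fun i => g (widen_ord qL i)); split=> [i j gij|i].
    have : f (enum_val (widen_ord qL i)) = f (enum_val (widen_ord qL j)) by rewrite !gP gij.
    by move=> /finj/enum_val_inj/(congr1 val) /= e; apply: val_inj.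
  by have := fXY (enum_val (widen_ord qL i)); rewrite gP.
move=> /card_geP[h [hinj hY]]; apply/card_geP.
have /card_geP[g [ginj gX]] : `I_n #<= X by rewrite (card_le_eqr Xn) card_lexx.
have lt_sub (i : 'I_q) : (n <= i -> i - n < q - n)%N.
  by move=> ni; rewrite ltn_sub2r // (leq_ltn_trans ni).
pose f (i : 'I_q) : T + U := match ltnP i n with
  | LtnNotGeq lt => inl (g (Ordinal lt))
  | GeqNotLtn ge => inr (h (Ordinal (lt_sub i ge))) end.
exists f; split=> [i j|i]; rewrite /f; last by case: ltnP => ? /=.
case: ltnP => ni; case: ltnP => nj //; last first.
  move=> [] /hinj /(congr1 val) /= e; apply: val_inj.
  by rewrite -[LHS](subnK ni) e; apply: subnK.
by move=> [] /ginj /(congr1 val) /= e; apply: val_inj.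
Qed.

End Cardinals.

(** * Bases of elementary quotients *)

Section Basis.
Local Open Scope ring_scope.
Variables (p : nat) (p_prime : prime p) (A : zmodType).

(** Indices may repeat in [r], so sums of combinations are concatenations; [comb_common] collects
    coefficients. *)
Definition comb (K : Type) (e : K -> A) (r : seq (K * int)) : A :=
  \sum_(u <- r) e u.1 *~ u.2.

Definition span_mod (K : choiceType) (e : K -> A) (X : set K) (Q : set A) : set A :=
  [set x | exists2 r, forall u, u \in r -> X u.1 & Q (x - comb e r)].

Definition free_mod (K : choiceType) (e : K -> A) (X : set K) (Q : set A) : Prop :=
  forall (s : seq K) (c : K -> int), uniq s -> (forall k, k \in s -> X k) ->
    Q (\sum_(k <- s) e k *~ c k) -> forall k, k \in s -> (p %| c k)%Z.

(** Indexing by a subset [X] lets one family, such as [socle_gen], give bases of several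
    quotients. *)
Definition basis_mod (P Q : set A) (K : choiceType) (X : set K) (e : K -> A) : Prop :=
  [/\ is_subgroup Q, forall k, X k -> P (e k), forall k, X k -> Q (e k *+ p),
      free_mod e X Q & P `<=` span_mod e X Q].

Section Span.
Variables (K : choiceType) (e : K -> A) (X : set K) (Q : set A).
Hypothesis Qs : is_subgroup Q.

Lemma span_mod_base x : Q x -> span_mod e X Q x.
Proof. by exists [::] => //; rewrite /comb big_nil subr0. Qed.

Lemma span_mod_gen k n : X k -> span_mod e X Q (e k *~ n).
Proof.
move=> Xk; exists [:: (k, n)]; first by move=> u; rewrite inE => /eqP ->.
by rewrite /comb big_seq1 subrr; apply: sg0.
Qed.

Lemma span_modD x y : span_mod e X Q x -> span_mod e X Q y -> span_mod e X Q (x + y).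
Proof.
move=> [r rX xr] [s sX ys]; exists (r ++ s).
  by move=> u; rewrite mem_cat => /orP[/rX|/sX].
by rewrite /comb big_cat /= opprD addrACA; apply: sgD.
Qed.

Lemma span_mod_sum (I : eqType) (r : seq I) (f : I -> A) :
  (forall i, i \in r -> span_mod e X Q (f i)) -> span_mod e X Q (\sum_(i <- r) f i).
Proof.
move=> fX; rewrite big_seq; elim/big_rec: _ => [|i x /fX]; last exact: span_modD.
by apply: span_mod_base; apply: sg0.
Qed.

Lemma span_mod_comb r : (forall u, u \in r -> X u.1) -> span_mod e X Q (comb e r).
Proof. by move=> rX; apply: span_mod_sum => u /rX; apply: span_mod_gen. Qed.

Lemma comb_common r s : uniq s -> (forall u, u \in r -> u.1 \in s) ->
  exists d : K -> int, comb e r = \sum_(k <- s) e k *~ d k.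
Proof.
move=> su; elim: r => [|[k n] r IH] rs.
  by exists (fun=> 0); rewrite /comb big_nil big1 // => k _; rewrite mulr0z.
have [|d dE] := IH; first by move=> u ur; apply: rs; rewrite inE ur orbT.
exists (fun l => d l + n * (l == k)%:Z).
rewrite /comb big_cons -/(comb e r) dE /=.
under [in RHS]eq_bigr do rewrite mulrzDr.
rewrite big_split /= addrC; congr (_ + _).
have ks : k \in s by apply: (rs (k, n)); rewrite mem_head.
rewrite (bigD1_seq k) //= eqxx mulr1 big1 ?addr0 // => l /negbTE ->.
by rewrite mulr0 mulr0z.
Qed.

End Span.

Lemma span_mod_subset (K : choiceType) (e : K -> A) (X Y : set K) (Q : set A) :
  X `<=` Y -> span_mod e X Q `<=` span_mod e Y Q.
Proof. by move=> XY x [r rX xr]; exists r => // u /rX/XY. Qed.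

Lemma span_mod_le (K : choiceType) (e : K -> A) (X : set K) (Q Q' : set A) :
  Q `<=` Q' -> span_mod e X Q `<=` span_mod e X Q'.
Proof. by move=> QQ' x [r rX xr]; exists r => //; apply: QQ'. Qed.

Lemma dim_ge_le (P P' Q : set A) m : P `<=` P' -> dim_ge p P Q m -> dim_ge p P' Q m.
Proof. by move=> PP' [x [xP xind]]; exists x; split=> // i; apply: PP'. Qed.

Lemma intr_Fp_eq0 (z : int) : (z%:~R == 0 :> 'F_p) = (p %| z)%Z.
Proof.
have pF : p \in [pchar 'F_p] by apply: pchar_Fp.
case: z => n; first by rewrite -(dvdn_pcharf pF).
by rewrite NegzE mulrNz oppr_eq0 dvdzE abszN -(dvdn_pcharf pF).
Qed.

(** [c] lifts to integers a nonzero vector of the left kernel over the field with [p] elements. *)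
Lemma singular_combination m n (M : 'I_m -> 'I_n -> int) : (n < m)%N ->
  exists2 c : 'I_m -> int, exists i, ~~ (p %| c i)%Z
    & forall j, (p %| \sum_i M i j * c i)%Z.
Proof.
move=> nm; pose N : 'M['F_p]_(m, n) := \matrix_(i, j) (M i j)%:~R.
have ker0 : kermx N != 0.
  rewrite -mxrank_eq0 mxrank_ker -lt0n subn_gt0.
  exact: leq_ltn_trans (rank_leq_col N) nm.
pose v := nz_row (kermx N).
have v0 : v != 0 by rewrite nz_row_eq0.
have vN : v *m N = 0 by apply/sub_kermxP/nz_row_sub.
have vE i : (((v 0 i : nat)%:Z)%:~R : 'F_p) = v 0 i by rewrite -pmulrn natr_Zp.
exists (fun i => (v 0 i : nat)%:Z).
  apply: contrapT => no; case/negP: v0; apply/eqP/rowP => i; rewrite mxE.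
  rewrite -vE; apply/eqP; rewrite intr_Fp_eq0; apply: contrapT => pv.
  by apply: no; exists i; apply/negP.
move=> j; rewrite -intr_Fp_eq0 rmorph_sum /=; apply/eqP.
have /rowP/(_ j) := vN; rewrite !mxE => {2}<-; apply: eq_bigr => i _.
by rewrite intrM vE mxE mulrC.
Qed.

(* Steinitz exchange over the field with [p] elements. *)
Lemma dim_basis (P Q : set A) (K : choiceType) (X : set K) (e : K -> A) m :
  basis_mod P Q X e -> dim_ge p P Q m <-> `I_m #<= X.
Proof.
move=> [Qs eP eQ efree espan]; split=> [[x [xP xind]]|/card_geP[f [finj fX]]]; last first.
  exists (e \o f); split=> [i|c Qc i]; first exact: eP.
  pose c' k := \sum_(j | f j == k) c j.
  have c'f j : c' (f j) = c j by rewrite /c' (big_pred1 j) // => l; rewrite (inj_eq finj).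
  rewrite -c'f; apply: (efree (map f (enum 'I_m))).
  - by rewrite map_inj_uniq ?enum_uniq.
  - by move=> _ /mapP[j _ ->].
  - by rewrite big_map big_enum /=; under eq_bigr do rewrite c'f.
  - by apply: map_f; rewrite mem_enum.
apply: contrapT => nX.
have /finite_seqP[s0 Xs0] : finite_set X.
  by apply: contrapT => /infinite_card_ge.
pose s := undup s0; have su : uniq s := undup_uniq _.
have Xs k : X k <-> k \in s by rewrite mem_undup Xs0.
have sm : (size s < m)%N.
  rewrite ltnNge; apply/negP => ms; apply: nX; apply/card_geP.
  exists (fun i : 'I_m => tnth (in_tuple s) (widen_ord ms i)); split=> [i j|i].
    by move=> /(elimT (tuple_uniqP (in_tuple s)) su) /(congr1 val) /= ij; apply: val_inj.
  by apply/Xs; apply: (mem_tnth _ (in_tuple s)).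
have /choice[d dP] : forall i, exists d : K -> int, Q (x i - \sum_(k <- s) e k *~ d k).
  move=> i; have [r rX Qr] := espan _ (xP i).
  have [|d dE] := @comb_common _ e r s su; first by move=> u /rX/Xs.
  by exists d; rewrite -dE.
have [c [i0 ci0] cP] :=
  singular_combination (fun i j => d i (tnth (in_tuple s) j)) sm.
case/negP: ci0; apply: xind.
have -> : \sum_i x i *~ c i = \sum_i (x i - \sum_(k <- s) e k *~ d i k) *~ c i
    + \sum_(k <- s) e k *~ (\sum_i d i k * c i).
  have -> : \sum_(k <- s) e k *~ (\sum_i d i k * c i)
      = \sum_i (\sum_(k <- s) e k *~ d i k) *~ c i.
    under eq_bigr do rewrite mulrz_sumr; rewrite exchange_big /=.
    apply: eq_bigr => i _; rewrite mulrz_suml; apply: eq_bigr => k _.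
    by rewrite mulrzA.
  by rewrite -big_split /=; apply: eq_bigr => i _; rewrite mulrzBl subrK.
apply: sgD => //; first by apply: sg_sum => // i _; apply: sgMz.
apply: sg_sum => // k ks.
have [j ->] : exists j, k = tnth (in_tuple s) j.
  by have /tnthP := (ks : k \in in_tuple s).
have /dvdzP[q ->] := cP j; rewrite mulrC mulrzA; apply: sgMz => //.
by apply: eQ; apply/Xs; apply: (mem_tnth _ (in_tuple s)).
Qed.

End Basis.

(** * Socles of groups with a basic subgroup *)

Section BasicDecomposition.
Local Open Scope ring_scope.
Variables (p : nat) (p_prime : prime p) (A : zmodType).

Lemma direct_sum_nat (S : nat -> set A) B : direct_sum S B -> forall x, B x ->
  exists M f, [/\ forall i, S i (f i), forall i, (M <= i)%N -> f i = 0
                & x = \sum_(0 <= i < M) f i].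
Proof.
move=> [Ss -> _] _ [s [f [su fS ->]]].
exists (\max_(i <- s) i.+1)%N, (fun i => if i \in s then f i else 0); split.
- by move=> i; case: ifP => _ //; apply: sg0.
- move=> i Mi; case: ifP => // iS; move: Mi.
  by rewrite leqNgt (leq_bigmax_seq (F := succn)).
- rewrite -big_mkcond /= -[RHS]big_filter; apply: perm_big; apply: uniq_perm => //.
    by apply: filter_uniq; apply: iota_uniq.
  move=> i; rewrite mem_filter mem_index_iota leq0n /=.
  by case: (boolP (i \in s)) => //= iS; rewrite (leq_bigmax_seq (F := succn)).
Qed.

Lemma direct_sum_nat0 (S : nat -> set A) B M (f : nat -> A) : direct_sum S B ->
    (forall i, S i (f i)) -> \sum_(0 <= i < M) f i = 0 ->
  forall i, (i < M)%N -> f i = 0.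
Proof.
move=> [_ _ ind] fS f0 i iM; apply: (ind (index_iota 0 M)) => //; first exact: iota_uniq.
by rewrite mem_index_iota.
Qed.

Lemma mulset_subgroup (G : set A) n : is_subgroup G -> is_subgroup (mulset n G).
Proof.
move=> Gs; split; first by exists 0; [exact: sg0 | rewrite mul0rz].
by move=> _ _ [x Gx <-] [y Gy <-]; exists (x - y); [exact: sgB | rewrite mulrzBl].
Qed.

Variables (G B : set A) (Bi : nat -> set A) (kappa : nat -> choiceType).
Hypotheses (Gs : is_subgroup G) (GB : basic_decomposition p G B Bi kappa).

Let Bdirect : direct_sum (fun i : nat => Bi i.+1) B.
Proof. by case: GB. Qed.

Let Bpure : is_pure B G.
Proof. by case: GB => -[]. Qed.

Lemma summand_sub i x : Bi i.+1 x -> B x.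
Proof.
case: Bdirect => Ss -> _ xi; exists [:: i], (fun j => if j == i then x else 0).
split=> // [j|]; last by rewrite big_seq1 eqxx.
by case: eqP => [->|_] //; apply: sg0.
Qed.

Lemma basic_sub x : B x -> G x.
Proof. by case: GB => -[_ BG _ _ _] _ _ /BG. Qed.

Lemma summand_subgroup i : is_subgroup (Bi i.+1).
Proof. by case: Bdirect. Qed.

Lemma summand_iso i : {f : {additive dsum_cyclic p i.+1 (kappa i.+1) -> A} |
  injective f /\ range f = Bi i.+1}.
Proof.
apply: cid; case: GB => _ _ /(_ i.+1 isT) [f finj fB].
by exists f.
Qed.

Definition iso i := projT1 (summand_iso i).

Lemma iso_inj i : injective (iso i).
Proof. by case: (projT2 (summand_iso i)). Qed.

Lemma iso_summand i z : Bi i.+1 (iso i z).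
Proof. by case: (projT2 (summand_iso i)) => _ <-; exists z. Qed.

Lemma iso_surj i x : Bi i.+1 x -> exists z, x = iso i z.
Proof. by case: (projT2 (summand_iso i)) => _ <- [z _ <-]; exists z. Qed.

Lemma Zp_annihil i (c : 'Z_(p ^ i.+1)) : c *+ p ^ i.+1 = 0.
Proof.
have p1 : (1 < p ^ i.+1)%N by rewrite -(exp1n i.+1) ltn_exp2r // prime_gt1.
by rewrite -mulr_natr pchar_Zp // mulr0.
Qed.

Lemma dsum_annihil i (z : dsum_cyclic p i.+1 (kappa i.+1)) : z *+ p ^ i.+1 = 0.
Proof. by apply/malgP => k; rewrite mcoeffMn mcoeff0 Zp_annihil. Qed.

Lemma summand_annihil i x : Bi i.+1 x -> x *+ p ^ i.+1 = 0.
Proof. by move=> /iso_surj[z ->]; rewrite -raddfMn dsum_annihil raddf0. Qed.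

(** With the default 0 for other tags, a sum over mixed indices can be read in each component
    separately. *)
Definition socle_vec i (u : {k & kappa k}) : dsum_cyclic p i.+1 (kappa i.+1) :=
  untag 0 (fun j : kappa i.+1 => @mkmalgU _ _ j 1 *+ p ^ i) u.

(* [p^(k-1)] times the generator of index [u] of [B_k], where [k = tag u], and
   [0] when [tag u = 0]. *)
Definition socle_gen (u : {k & kappa k}) : A := iso (tag u).-1 (socle_vec (tag u).-1 u).

Lemma socle_vecE i j : socle_vec i (Tagged kappa (j : kappa i.+1)) = @mkmalgU _ _ j 1 *+ p ^ i.
Proof. by rewrite /socle_vec (untagE _ _ (erefl : tag (Tagged kappa j) = i.+1)). Qed.

Lemma socle_vec_neq i u : tag u != i.+1 -> socle_vec i u = 0.
Proof. by move=> ui; rewrite /socle_vec untag_dflt. Qed.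


Lemma socle_genE i u : tag u = i.+1 -> socle_gen u = iso i (socle_vec i u).
Proof. by rewrite /socle_gen => ->. Qed.

Lemma socle_gen_root u : exists2 w, B w & socle_gen u = w *+ p ^ (tag u).-1.
Proof.
case: u => -[|i] j; rewrite /socle_gen /=.
  exists 0; first by apply: (@summand_sub 0); apply: sg0; apply: summand_subgroup.
  by rewrite socle_vec_neq // raddf0 mul0rn.
exists (iso i (@mkmalgU _ _ j 1)); first exact/summand_sub/iso_summand.
by rewrite -raddfMn -socle_vecE.
Qed.

Lemma socle_gen_p u : socle_gen u *+ p = 0.
Proof.
case: u => -[|i] j; rewrite /socle_gen /=.
  by rewrite socle_vec_neq // raddf0 mul0rn.
by rewrite -raddfMn socle_vecE -mulrnA -expnSr dsum_annihil raddf0.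
Qed.

Lemma socle_vec_coeff i u (j : kappa i.+1) :
  mcoeff j (socle_vec i u) = if u == Tagged kappa j then 1 *+ p ^ i else 0.
Proof.
have [->|uj] := eqVneq; first by rewrite socle_vecE mcoeffMn mcoeffUU.
have [ui|ui] := eqVneq (tag u) i.+1; last by rewrite socle_vec_neq // mcoeff0.
case: u ui uj => k l /= kE; subst k => lj.
have {}lj : l != j by apply: contraNneq lj => ->.
by rewrite socle_vecE mcoeffMn mcoeffU (negbTE lj) mulr0n mul0rn.
Qed.

Lemma Zp_top_dvd i (c : int) : (1 *+ p ^ i : 'Z_(p ^ i.+1)) *~ c = 0 -> (p %| c)%Z.
Proof.
apply: annihil_dvd => //; first by rewrite -mulrnA -expnSr Zp_annihil.
have pi : (1 < p ^ i.+1)%N by rewrite -(exp1n i.+1) ltn_exp2r // prime_gt1.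
apply/eqP => /(congr1 val); rewrite /= val_Zp_nat // modn_small; last first.
  by rewrite ltn_exp2l // prime_gt1.
by move/eqP; rewrite expn_eq0 eqn0Ngt prime_gt0.
Qed.

Lemma socle_gen_sum M (s : seq {k & kappa k}) (c : {k & kappa k} -> int) :
    (forall u, u \in s -> (0 < tag u <= M)%N) ->
  \sum_(u <- s) socle_gen u *~ c u
  = \sum_(0 <= i < M) iso i (\sum_(u <- s) socle_vec i u *~ c u).
Proof.
move=> sM; under [RHS]eq_bigr do rewrite raddf_sum.
rewrite exchange_big /= !big_seq; apply: eq_bigr => u /sM.
case uk: (tag u) => [|k] // kM.
have kM' : k \in index_iota 0 M by rewrite mem_index_iota.
rewrite (bigD1_seq k) ?iota_uniq //= big1 => [|i ik].
  by rewrite addr0 raddfMz -socle_genE.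
by rewrite socle_vec_neq ?mul0rz ?raddf0 // uk eqSS eq_sym.
Qed.

(** By purity a combination in [p^r G] lies in [p^r B]; as [p^r] kills the summands of exponent at
    most [p^r], each component of the combination vanishes. *)
Lemma socle_gen_free r :
  free_mod p socle_gen [set u | (0 < tag u <= r)%N] (mulset (p ^ r)%N G).
Proof.
move=> s c su sr Qc.
have BS : is_subgroup B by case: GB => -[].
have Bc : B (\sum_(u <- s) socle_gen u *~ c u).
  apply: sg_sum => // u _; apply: sgMz => //; have [w wB ->] := socle_gen_root u.
  exact: sgMn.
have [b Bb bE] : mulset (p ^ r)%N B (\sum_(u <- s) socle_gen u *~ c u).
  by rewrite Bpure.
have [M [g [gB gM bg]]] := direct_sum_nat Bdirect Bb.
pose N := maxn M r.
have bN : b = \sum_(0 <= i < N) g i.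
  rewrite bg (big_cat_nat (leq0n M) (leq_maxl M r : (M <= N)%N)) /=.
  rewrite [X in _ = _ + X]big1_seq ?addr0 // => i /andP[_]; rewrite mem_index_iota.
  by case/andP=> Mi _; apply: gM.
have comp0 i : (i < N)%N -> iso i (\sum_(u <- s) socle_vec i u *~ c u) - g i *+ p ^ r = 0.
  apply: (direct_sum_nat0 (f := fun i => iso i (\sum_(u <- s) socle_vec i u *~ c u)
    - g i *+ p ^ r) Bdirect) => [k|].
    apply: sgB; [exact: summand_subgroup | exact: iso_summand |].
    by apply: sgMn; [exact: summand_subgroup | exact: gB].
  rewrite sumrB -socle_gen_sum; last first.
    by move=> u /sr /andP[-> ur]; rewrite leq_max ur orbT.
  by rewrite sumrMnl -bN -bE subrr.
move=> u us; have /andP[] := sr u us.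
case uE : u us => [[|i] j] //= us _ ir.
have iN : (i < N)%N by rewrite leq_max ir orbT.
have := comp0 i iN.
have -> : g i *+ p ^ r = 0.
  by rewrite -(subnKC ir) expnD mulrnA summand_annihil ?mul0rn.
rewrite subr0 -[X in _ = X](raddf0 (iso i)) => /iso_inj /(congr1 (mcoeff j)).
rewrite mcoeff0 raddf_sum (bigD1_seq (Tagged kappa (j : kappa i.+1))) //= big1 => [|v vj].
  by rewrite addr0 raddfMz /= socle_vec_coeff eqxx => /Zp_top_dvd.
by rewrite raddfMz /= socle_vec_coeff (negbTE vj) mul0rz.
Qed.

Lemma dsum_divisible i h (z : dsum_cyclic p i.+1 (kappa i.+1)) :
  (h < i)%N -> z *+ p ^ h.+1 = 0 -> exists z', z = z' *+ p.
Proof.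
move=> hi zh.
have root (c : 'Z_(p ^ i.+1)) : c *+ p ^ h.+1 = 0 -> exists d, c = d *+ p.
  move=> ch; have pi : (1 < p ^ i.+1)%N by rewrite -(exp1n i.+1) ltn_exp2r // prime_gt1.
  have /dvdnP[q qE] : (p %| c)%N.
    have : (p ^ i.+1 %| c * p ^ h.+1)%N.
      by rewrite /dvdn -val_Zp_nat // natrM natr_Zp mulr_natr ch.
    move: (nat_of_ord c) => n; rewrite -(subnK (leqW hi : (h.+1 <= i.+1)%N)) expnD.
    rewrite dvdn_pmul2r ?expn_gt0 ?prime_gt0 //.
    by apply: dvdn_trans; rewrite dvdn_exp // subn_gt0 ltnS.
  by exists q%:R; rewrite -mulrnA -qE natr_Zp.
have /choice[d dP] : forall k, exists d, mcoeff k z = d *+ p.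
  by move=> k; apply: root; rewrite -mcoeffMn zh mcoeff0.
exists (\sum_(k <- finmap.enum_fset (msupp z)) @mkmalgU _ _ k (d k)).
rewrite {1}(monalgE z) -sumrMnl; apply: eq_bigr => k _.
by rewrite dP monalgUMn.
Qed.

(** Write x = p^h y. Divisibility of G/B replaces [y] by [b0] in [B] modulo p G, and purity corrects
    [b0] to some [b] killed by p^(h+1). Thus [x] is congruent to p^h b, which is analysed in the
    cyclic summands. *)
Lemma socle_gen_step h x : mulset (p ^ h)%N G x -> x *+ p = 0 ->
  span_mod socle_gen [set u | tag u = h.+1] (mulset (p ^ h.+1)%N G) x.
Proof.
move=> [y Gy yx] px; have Qs := mulset_subgroup (p ^ h.+1)%N Gs.
have p0 : (p%:Z != 0)%R by rewrite eqz_nat -lt0n prime_gt0.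
have Gdiv : divisible_quotient G B by case: GB => -[].
have BS : is_subgroup B by case: GB => -[].
have [z Gz Bz] := Gdiv p p0 y Gy.
pose b0 := y - z *~ p.
have {}yx : y *+ p ^ h = x := yx.
have b0E : b0 *+ p ^ h.+1 = - z *+ p ^ h.+2.
  rewrite mulrnBl expnSr mulrnA yx px sub0r mulNrn; congr (- _).
  by rewrite -pmulrn -mulrnA -expnSr -expnS.
have [b1 Bb1 b1E] : mulset (p ^ h.+2)%N B (b0 *+ p ^ h.+1).
  rewrite Bpure; split; first exact: sgMn.
  by exists (- z); [exact: sgN | rewrite b0E].
have {}b1E : b1 *+ p ^ h.+2 = b0 *+ p ^ h.+1 := b1E.
pose b := b0 - b1 *+ p.
have Bb : B b by apply: sgB => //; apply: sgMn.
have pb : b *+ p ^ h.+1 = 0.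
  by rewrite mulrnBl -b1E -mulrnA -expnS subrr.
have xb : mulset (p ^ h.+1)%N G (x - b *+ p ^ h).
  exists (z + b1); first by apply: sgD => //; apply: basic_sub.
  have -> : b = y - (z + b1) *+ p by rewrite mulrnDl opprD addrA.
  by rewrite mulrnBl yx -mulrnA -expnS opprB addrCA subrr addr0.
rewrite -[x](subrK (b *+ p ^ h)); apply: span_modD => //.
  exact: span_mod_base.
have [M [c [cB _ bc]]] := direct_sum_nat Bdirect Bb.
have c0 i : (i < M)%N -> c i *+ p ^ h.+1 = 0.
  apply: (direct_sum_nat0 (f := fun i => c i *+ p ^ h.+1) Bdirect) => [k|].
    by apply: sgMn => //; exact: summand_subgroup.
  by rewrite sumrMnl -bc.
rewrite bc -sumrMnl; apply: span_mod_sum => // i; rewrite mem_index_iota => /andP[_ iM].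
have [v vE] := iso_surj (cB i).
have vh : v *+ p ^ h.+1 = 0.
  by apply: iso_inj; rewrite raddfMn -vE c0 // raddf0.
(* The component lies in [Bi i.+1]: below [h] it is killed by p^h; above [h], being killed by
   p^(h+1), it is divisible by [p]; only [i = h] contributes generators. *)
case: (ltngtP i h) => [ih|hi|ih].
- have -> : c i *+ p ^ h = 0.
    by rewrite -(subnKC ih) expnD mulrnA summand_annihil ?mul0rn.
  by apply: span_mod_base; apply: sg0.
- have [v' v'E] := dsum_divisible hi vh.
  apply: span_mod_base; exists (iso i v'); first exact/basic_sub/summand_sub/iso_summand.
  by rewrite vE v'E raddfMn -pmulrn -mulrnA -expnS.
rewrite ih in cB v vE vh *.
rewrite vE -raddfMn (monalgE v) -sumrMnl raddf_sum; apply: span_mod_sum => // k _.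
have -> : @mkmalgU _ _ k (mcoeff k v) *+ p ^ h
    = socle_vec h (Tagged kappa (k : kappa h.+1)) *~ (mcoeff k v : nat)%:Z.
  by rewrite socle_vecE -pmulrn mulrnAC -[X in _ = X *+ _]monalgUMn natr_Zp.
by rewrite raddfMz -socle_genE //; apply: span_mod_gen.
Qed.

Lemma socle_gen_span h r x : (h <= r)%N -> mulset (p ^ h)%N G x -> x *+ p = 0 ->
  span_mod socle_gen [set u | (h < tag u <= r)%N] (mulset (p ^ r)%N G) x.
Proof.
move=> hr xh px; elim: r hr => [|r IH].
  by rewrite leqn0 => /eqP h0; rewrite h0 in xh *; apply: span_mod_base.
rewrite leq_eqVlt => /orP[/eqP hr|]; first by rewrite hr in xh *; apply: span_mod_base.
rewrite ltnS => hr; have [L LX xL] := IH hr.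
have Qs := mulset_subgroup (p ^ r.+1)%N Gs.
rewrite -[x](subrK (comb socle_gen L)); apply: span_modD => //.
  have px' : (x - comb socle_gen L) *+ p = 0.
    rewrite mulrnBl px -sumrMnl big1 ?subr0 // => u _.
    by rewrite pmulrn mulrzAC -pmulrn socle_gen_p mul0rz.
  apply: span_mod_subset (socle_gen_step xL px') => u /= ->.
  by rewrite ltnS hr leqnn.
apply: span_mod_comb => // u /LX /= /andP[-> ur]; exact: leqW.
Qed.

End BasicDecomposition.

Section SumBasis.
Local Open Scope ring_scope.
Variables (p : nat) (A : zmodType).

Lemma sum_basis (D R P1 P2 P : set A) (K1 K2 : choiceType) (X1 : set K1) (X2 : set K2)
    (e1 : K1 -> A) (e2 : K2 -> A) :
    direct_sum2 D R [set: A] -> P1 `<=` D -> P2 `<=` R -> P1 `<=` P -> P2 `<=` P ->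
    (forall x, P x -> exists x1 x2, [/\ P1 x1, P2 x2 & x = x1 + x2]) ->
    basis_mod p P1 [set 0] X1 e1 -> basis_mod p P2 [set 0] X2 e2 ->
  basis_mod p P [set 0] (sum_set X1 X2)
    (fun u => match u with inl x => e1 x | inr y => e2 y end).
Proof.
set e := fun u => _; move=> [Ds Rs DR0 _] P1D P2R P1P P2P PE.
move=> [zs e1P e1p free1 span1] [_ e2P e2p free2 span2].
have span12 x1 x2 : span_mod e1 X1 [set 0] x1 -> span_mod e2 X2 [set 0] x2 ->
    span_mod e (sum_set X1 X2) [set 0] (x1 + x2).
  move=> [r1 rX1 /= /subr0_eq ->] [r2 rX2 /= /subr0_eq ->].
  apply: span_modD => //.
    apply: span_mod_sum => // u /rX1 uX.
    exact: (@span_mod_gen _ _ e (sum_set X1 X2) _ zs (inl u.1) u.2 uX).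
  apply: span_mod_sum => // u /rX2 uX.
  exact: (@span_mod_gen _ _ e (sum_set X1 X2) _ zs (inr u.1) u.2 uX).
split=> //.
- by case=> k; [move=> /e1P/P1P | move=> /e2P/P2P].
- by case=> k; [apply: e1p | apply: e2p].
- move=> s c su sX /= sum0.
  pose s1 := pmap (fun u : K1 + K2 => if u is inl x then Some x else None) s.
  pose s2 := pmap (fun u : K1 + K2 => if u is inr x then Some x else None) s.
  have s1P x : (x \in s1) = (inl x \in s).
    rewrite /s1; elim: (s) => [|[y|y] r IH] //=; rewrite !inE IH //.
  have s2P x : (x \in s2) = (inr x \in s).
    rewrite /s2; elim: (s) => [|[y|y] r IH] //=; rewrite !inE IH //.
  have s1u : uniq s1.
    move: su; rewrite /s1; elim: (s) => [|[y|y] r IH] //= /andP[yr /IH ru] //.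
    rewrite ru andbT; apply: contra yr; rewrite mem_pmap => /mapP[[z|z] zr] // [->].
    exact: zr.
  have s2u : uniq s2.
    move: su; rewrite /s2; elim: (s) => [|[y|y] r IH] //= /andP[yr /IH ru] //.
    rewrite ru andbT; apply: contra yr; rewrite mem_pmap => /mapP[[z|z] zr] // [->].
    exact: zr.
  have split_sum : \sum_(u <- s) e u *~ c u
      = \sum_(x <- s1) e1 x *~ c (inl x) + \sum_(y <- s2) e2 y *~ c (inr y).
    rewrite /s1 /s2; elim: (s) => [|[y|y] r IH] /=; rewrite ?big_nil ?addr0 // !big_cons IH.
      by rewrite addrA.
    by rewrite addrCA.
  rewrite split_sum in sum0; set S1 := \sum_(x <- s1) _ in sum0.
  set S2 := \sum_(x <- s2) _ in sum0.
  have S1D : D S1.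
    by apply: sg_sum => // x xs; apply: sgMz => //; apply/P1D/e1P/(sX (inl x)); rewrite -s1P.
  have S2R : R S2.
    by apply: sg_sum => // x xs; apply: sgMz => //; apply/P2R/e2P/(sX (inr x)); rewrite -s2P.
  have S10 : S1 = 0.
    suff : (D `&` R) S1 by rewrite DR0.
    split=> //; have -> : S1 = - S2 by apply/eqP; rewrite -addr_eq0 sum0.
    exact: sgN.
  have S20 : S2 = 0 by move: sum0; rewrite S10 add0r.
  case=> k ks.
    apply: (free1 s1 (fun x => c (inl x))) => //; last by rewrite s1P.
    by move=> x; rewrite s1P => /sX.
  apply: (free2 s2 (fun x => c (inr x))) => //; last by rewrite s2P.
  by move=> x; rewrite s2P => /sX.
- by move=> x /PE[x1 [x2 [/span1 x1s /span2 x2s ->]]]; apply: span12.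
Qed.

End SumBasis.

(** * Boundedness and ranks read off socles *)

Section Socle.
Local Open Scope ring_scope.
Variables (p : nat) (p_prime : prime p) (A : zmodType) (Ap : torsion p A).

Definition socle_at (G : set A) k : set A := [set x | mulset (p ^ k)%N G x /\ x *+ p = 0].

Lemma divisible_of_p (H : set A) : is_subgroup H ->
  (forall x, H x -> exists2 y, H y & x = y *+ p) -> divisible H.
Proof.
move=> Hs Hp n n0; apply/seteqP; split=> [_ [x Hx <-]|]; first exact: sgMz.
have [m nm] := ubnP `|n|%N; elim: m n n0 nm => // m IH n n0 nm x Hx.
have [/dvdzP[q nE]|pn] := boolP (p %| n)%Z; last first.
  have [k xk] := Ap x; have [u [v e]] := bezout_coprime p_prime k pn.
  exists (x *~ u); first exact: sgMz.
  by rewrite {2}(mulz_bezout x e) -pmulrn xk mul0rz addr0 mulrzAC.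
have [y Hy xE] := Hp x Hx.
have q0 : q != 0 by apply: contraNneq n0 => q0; rewrite nE q0 mul0r.
have [|z Hz zE] := IH q q0 _ y Hy.
  rewrite -ltnS (leq_trans _ nm) // ltnS nE abszM ltn_Pmulr ?prime_gt1 //.
  by rewrite absz_gt0.
by exists z => //; rewrite nE mulrzA zE xE.
Qed.

Lemma socle_at_subgroup (G : set A) k : is_subgroup G -> is_subgroup (socle_at G k).
Proof.
move=> Gs; have Ms := mulset_subgroup (p ^ k)%N Gs; split=> [|x y [xG px] [yG py]].
  by split; [exact: sg0 | rewrite mul0rn].
by split; [exact: sgB | rewrite mulrnBl px py subrr].
Qed.

Lemma mulset_le (G : set A) k l : is_subgroup G -> (k <= l)%N ->
  mulset (p ^ l)%N G `<=` mulset (p ^ k)%N G.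
Proof.
move=> Gs kl _ [x Gx <-]; exists (x *+ p ^ (l - k)); first exact: sgMn.
by rewrite -!pmulrn -mulrnA -expnD subnK.
Qed.

(* Once the finite dimension of the socles stabilizes, the elements of [p^k G]
   are divisible by [p] in [p^k G], by induction on their orders. *)
Lemma bounded_of_finite_socle (R G : set A) i m : reduced R -> is_subgroup G -> G `<=` R ->
  ~ dim_ge p (socle_at G i) [set 0] m -> exists N, forall x, G x -> x *+ p ^ N = 0.
Proof.
move=> Rred Gs GR fin.
(* The least such bound is [m0.+1], reached at [k]: all socles have dimension at least [m0], and
   that of [p^k G] at most [m0], so the decreasing socles are constant from [k] on. *)
pose small m' := `[< exists k, ~ dim_ge p (socle_at G k) [set 0] m' >].
have ex_small : exists m', small m' by exists m; apply/asboolP; exists i.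
case: (ex_minnP ex_small) => -[|{fin}m0 /asboolP[k fin] mmin].
  by move=> /asboolP[k nk] _; case: nk; exists (fun=> 0); split=> [[]|c _ []].
exists k; pose H := mulset (p ^ k)%N G; have Hs : is_subgroup H := mulset_subgroup _ Gs.
have zs := zero_subgroup A.
have stable l : (k <= l)%N -> socle_at G k `<=` socle_at G l.
  move=> kl y yk; apply: contrapT => yl; apply: fin.
  have [t [tP tind]] : dim_ge p (socle_at G l) [set 0] m0.
    apply: contrapT => nd; suff /mmin : small m0 by rewrite ltnn.
    by apply/asboolP; exists l.
  exists (cons_fun y t); split.
    by apply: cons_funP => // j; have [tG tp] := tP j; split=> //; apply: mulset_le tG.
  apply: indep_cons => //=; last by case: yk.
  move=> c c0 /= e; apply/negPn/negP => /(bezout_prime p_prime)[u [v uv]]; apply: yl.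
  have ls := socle_at_subgroup l Gs.
  rewrite (mulz_bezout y uv) -pmulrn; have [_ ->] := yk; rewrite mul0rz addr0.
  apply: sgMz => //; rewrite -[y *~ c0](addrK (\sum_i t i *~ c i)) e sub0r.
  by apply: sgN => //; apply: sg_sum => // j _; apply: sgMz.
suff H0 : H = [set 0].
  move=> x Gx; have : H (x *+ p ^ k) by exists x.
  by rewrite H0.
apply: Rred => //; first by move=> _ [x Gx <-]; apply: GR; exact: sgMz.
apply: divisible_of_p => // x Hx; have [e] := Ap x.
elim: e x Hx => [|e IH] x Hx xe.
  exists 0; first exact: sg0. by move: xe; rewrite expn0 mulr1n mul0rn.
have : socle_at G k (x *+ p ^ e).
  by split; [apply: sgMn | rewrite -mulrnA -expnSr].
(* Height [k + e.+1] lets [p^e x] be written as [p^e] times [p] times an element of [p^k G]; the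
   difference with [x] has smaller exponent. *)
move=> /(stable (k + e.+1)%N (leq_addr _ _))[[g Gg gE] _].
have {}gE : x *+ p ^ e = g *+ p ^ k *+ p *+ p ^ e.
  by rewrite -gE -!mulrnA -expnS -expnD.
have Hg : H (g *+ p ^ k) by exists g.
have [||y Hy yE] := IH (x - g *+ p ^ k *+ p).
- by apply: sgB => //; apply: sgMn.
- by rewrite mulrnBl gE subrr.
by exists (y + g *+ p ^ k); [exact: sgD | rewrite mulrnDl -yE subrK].
Qed.

Lemma has_orderz (x : A) n (z : int) : has_order x n -> (x *~ z == 0) = (n %| z)%Z.
Proof. by move=> xn; case: z => z; rewrite ?NegzE ?mulrNz ?oppr_eq0 dvdzE /= xn. Qed.

(** Rank is the dimension of the socle: each element of [X] is replaced by its multiple of order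
    [p], and a socle element outside their span could be added to [X]. *)
Lemma maximal_independent_basis (G X : set A) : is_subgroup G -> maximal_independent p G X ->
  exists e : A -> A, basis_mod p [set x | G x /\ x *+ p = 0] [set 0] X e.
Proof.
move=> Gs [[XG Xord Xind] Xmax].
have /choice[o oP] : forall x, exists k, X x -> has_order x (p ^ k.+1).
  move=> x; have [/Xord[[|k] // _ xk]|nX] := pselect (X x); last by exists 0%N.
  by exists k.
pose e x := x *+ p ^ o x.
have ep x : X x -> e x *+ p = 0.
  by move=> /oP xo; apply/eqP; rewrite -mulrnA -expnSr xo.
have e0 x : X x -> e x != 0.
  by move=> /oP ->; rewrite dvdn_Pexp2l ?prime_gt1 // ltnn.
have zs := zero_subgroup A.
have eP x n : X x -> (x *~ n) *+ p = 0 -> exists q, x *~ n = e x *~ q.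
  move=> Xx /eqP; rewrite pmulrn -mulrzA (has_orderz _ (oP x Xx)) => /dvdzP[q].
  rewrite expnSr PoszM mulrA => /mulIf -> ; last by rewrite eqz_nat -lt0n prime_gt0.
  by exists q; rewrite mulrC mulrzA.
exists e; split=> //.
- by move=> x Xx; split; [by apply: sgMn => //; apply: XG | exact: ep].
- move=> s c su sX /= sum0 x xs; apply: (annihil_dvd p_prime (ep x (sX x xs)) (e0 x (sX x xs))).
  have sum0' : \sum_(a <- s) a *~ ((p ^ o a)%N%:Z * c a) = 0.
    by rewrite -[RHS]sum0; apply: eq_bigr => a _; rewrite mulrzA.
  by have := Xind s _ su sX sum0' x xs; rewrite mulrzA.
move=> y [Gy py]; apply: contrapT => yspan.
have y0 : y != 0 by apply/eqP => y0; apply: yspan; apply: span_mod_base.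
have yX : ~ X y.
  move=> Xy; apply: yspan; have [|q] := eP y 1 Xy; first by rewrite mulr1z.
  by rewrite mulr1z => ->; apply: span_mod_gen.
suff XyX : X `|` [set y] = X by apply: yX; rewrite -XyX; right.
apply: Xmax; last by move=> x Xx; left.
split.
- by move=> x [/XG|->].
- move=> x [/Xord //|->]; exists 1%N => // m; rewrite expn1.
  apply/eqP/idP => [ym|/dvdnP[q ->]]; last by rewrite mulnC mulrnA py mul0rn.
  by have := annihil_dvd p_prime py y0 (n := m%:Z); apply.
move=> s m su sXy sum0.
have [ys|ys] := boolP (y \in s); last first.
  apply: Xind => // a as_; case: (sXy a as_) => // ay.
  by case/negP: ys; rewrite -ay.
have remX a : a \in rem y s -> X a.
  rewrite mem_rem_uniq // inE => /andP[/eqP ay as_].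
  by case: (sXy a as_).
have sumE : y *~ m y + \sum_(a <- rem y s) a *~ m a = 0.
  by move: sum0; rewrite (perm_big _ (perm_to_rem ys)) big_cons.
have [pm|/(bezout_prime p_prime)[u [v uv]]] := boolP (p %| m y)%Z.
  have ym := dvd_annihil py pm; rewrite ym add0r in sumE => a as_.
  have [->//|ay] := eqVneq a y.
  by apply: (Xind (rem y s)); rewrite ?rem_uniq // mem_rem_uniq // inE ay.
case: yspan.
have yE : y = \sum_(a <- rem y s) a *~ (- m a * u).
  rewrite {1}(mulz_bezout y uv) -pmulrn py mul0rz addr0.
  rewrite -[y *~ m y](addrK (\sum_(a <- rem y s) a *~ m a)) sumE sub0r mulNrz mulrz_suml.
  by rewrite -sumrN; apply: eq_bigr => a _; rewrite mulNr mulrNz mulrzA.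
(* As [y] has order [p], independence of [X] makes each term of its expansion killed by [p], hence a
   multiple of [e a]. *)
have pE : \sum_(a <- rem y s) a *~ (- m a * u * p%:Z) = 0.
  rewrite -[RHS]py {2}yE pmulrn mulrz_suml; apply: eq_bigr => a _.
  by rewrite mulrzA.
rewrite yE; apply: span_mod_sum => // a ar.
have [|q ->] := eP a (- m a * u) (remX a ar); last exact/span_mod_gen/remX.
rewrite pmulrn -mulrzA; apply: (Xind (rem y s) (fun a => - m a * u * p%:Z)) => //.
exact: rem_uniq.
Qed.

End Socle.

(** * The invariants of the theorem *)

Section Invariants.
Local Open Scope ring_scope.
Variables (p : nat) (p_prime : prime p) (A : zmodType) (Ap : torsion p A).
Variables (D R : set A) (DR : direct_sum2 D R [set: A]) (D_div : divisible D).

Lemma pexp_neq0 k : ((p ^ k)%N%:Z != 0).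
Proof. by rewrite eqz_nat -lt0n expn_gt0 prime_gt0. Qed.

Lemma divisible_root x k : D x -> exists2 y, D y & x = y *+ p ^ k.
Proof. by rewrite -{1}(D_div (pexp_neq0 k)) => -[y Dy <-]; exists y. Qed.

Lemma direct_decomp x : exists d r, [/\ D d, R r & x = d + r].
Proof. by case: DR => _ _ _ E; have : [set: A] x by []; rewrite {1}E. Qed.

Lemma direct_summand_height x n : R x -> hge p n x -> mulset (p ^ n)%N R x.
Proof.
move=> Rx [y yE]; have [d [r [Dd Rr yE']]] := direct_decomp y.
have [Ds Rs DR0 _] := DR; exists r => //; rewrite -pmulrn.
have : (D `&` R) (d *+ p ^ n).
  split; first exact: sgMn.
  have -> : d *+ p ^ n = x - r *+ p ^ n by rewrite yE yE' mulrnDl addrK.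
  by apply: sgB => //; apply: sgMn.
by rewrite DR0 /= => d0; rewrite yE yE' mulrnDl d0 add0r.
Qed.

(** [D] contributes only elements of infinite height, so the quotient for [A] is that for [R]. *)
Lemma ulm_num_basis (B : set A) (Bi : nat -> set A) (kappa : nat -> choiceType)
    (RB : basic_decomposition p R B Bi kappa) h :
  basis_mod p (@ulm_num p A h) (@hge p A h.+1) [set u | tag u = h.+1] (socle_gen RB).
Proof.
have [Ds Rs DR0 _] := DR.
have BR x : B x -> R x by apply: (basic_sub RB).
have mul_hge n x : mulset (p ^ n)%N R x -> hge p n x by move=> [y _ <-]; exists y.
split.
- exact: hge_subgroup.
- move=> u uh; have [w _ wE] := socle_gen_root RB u.
  by split; [exists w; rewrite wE uh | apply: socle_gen_p].
- by move=> u _; rewrite (socle_gen_p p_prime RB); apply: hge0.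
- move=> s c su sh Q; apply: (@socle_gen_free _ p_prime _ _ _ _ _ RB h.+1 s c su) => //.
    by move=> u /sh /= ->; rewrite leqnn.
  apply: direct_summand_height => //; apply: sg_sum => // u _; apply: sgMz => //.
  have [w Bw ->] := socle_gen_root RB u.
  by apply: sgMn => //; apply: BR.
move=> x [[y yE] px]; have [d [r [Dd Rr yE']]] := direct_decomp y.
have pr : r *+ p ^ h *+ p = 0.
  have : (D `&` R) (r *+ p ^ h *+ p).
    split; last by do 2! apply: sgMn => //.
    have -> : r *+ p ^ h *+ p = - (d *+ p ^ h *+ p).
      by apply/eqP; rewrite -addr_eq0 addrC -!mulrnDl -yE' -yE px.
    by apply: sgN => //; do 2! apply: sgMn => //.
  by rewrite DR0.
have hs := @hge_subgroup p A h.+1.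
rewrite yE yE' mulrnDl; apply: span_modD => //.
  apply: span_mod_base; have [d' _ ->] := divisible_root 1 Dd.
  by exists d'; rewrite -mulrnA -expnD.
apply: (span_mod_le (mul_hge h.+1)).
by apply: (socle_gen_step p_prime Rs RB) => //; exists r.
Qed.

Lemma tag_card (kappa : nat -> choiceType) k :
  [set u : {i & kappa i} | tag u = k] #= [set: kappa k].
Proof.
have -> : [set u : {i & kappa i} | tag u = k]
    = [set Tagged kappa (j : kappa k) | j in [set: kappa k]].
  apply/seteqP; split=> [[i j] /= ik|_ [j _ <-] //].
  by subst i; exists j.
apply: inj_card_eq => i j _ _ /eqP.
by rewrite eq_Tagged => /eqP.
Qed.

Lemma ulm_num_card (B : set A) (Bi : nat -> set A) (kappa : nat -> choiceType) :
    basic_decomposition p R B Bi kappa ->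
  forall h m, dim_ge p (@ulm_num p A h) (@hge p A h.+1) m <-> `I_m #<= [set: kappa h.+1].
Proof.
move=> RB h m; rewrite (dim_basis p_prime m (ulm_num_basis RB h)).
by rewrite (card_le_eqr (tag_card kappa h.+1)).
Qed.

Let U := first_ulm p R.

Lemma first_ulm_subgroup : is_subgroup U.
Proof.
have [_ Rs _ _] := DR; split=> [n _|x y Ux Uy n n0].
  by apply: sg0; apply: mulset_subgroup.
have Ms := mulset_subgroup (p ^ n)%N Rs.
by apply: sgB => //; [apply: Ux | apply: Uy].
Qed.

Lemma first_ulm_sub : U `<=` R.
Proof.
have [_ Rs _ _] := DR; move=> x /(_ 1%N isT) [y Ry <-]; exact: sgMz.
Qed.

Lemma first_ulm_height x : U x -> infinite_height p x.
Proof.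
move=> Ux [|n]; first exact: hge0n.
by have [y _ <-] := Ux n.+1 isT; exists y.
Qed.

Lemma divisible_height x : D x -> infinite_height p x.
Proof. by move=> Dx n; have [y _ ->] := divisible_root n Dx; exists y. Qed.

Lemma infinite_height_decomp x : infinite_height p x ->
  exists d r, [/\ D d, U r & x = d + r].
Proof.
move=> xinf; have [d [r [Dd Rr xE]]] := direct_decomp x; exists d, r; split=> // n n0.
apply: direct_summand_height => //; rewrite -[r](addKr d) addrC -xE.
by apply: hgeB; [apply: xinf | apply: divisible_height].
Qed.

Lemma divisible_inf_socle i : [set x | D x /\ x *+ p = 0] `<=` @inf_socle p A i.
Proof.
move=> x [Dx px]; split=> //; have [y Dy xE] := divisible_root i Dx.
by exists y => //; apply: divisible_height.
Qed.

Lemma first_ulm_inf_socle i : socle_at p U i `<=` @inf_socle p A i.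
Proof. by move=> x [[y Uy <-] px]; split=> //; exists y => //; apply: first_ulm_height. Qed.

Hypothesis R_red : reduced R.

Lemma unbounded_dim i m :
  (exists N, forall x, U x -> x *+ p ^ N = 0) \/ dim_ge p (socle_at p U i) [set 0] m.
Proof.
have [|nd] := pselect (dim_ge p (socle_at p U i) [set 0] m); [by right | left].
exact: (bounded_of_finite_socle p_prime Ap R_red first_ulm_subgroup first_ulm_sub nd).
Qed.

Variables (kappa0 finr : Type) (D_rank : has_rank p D kappa0) (U_finr : has_final_rank p U finr).

Lemma final_rank_nonempty : [set: finr] <> set0 ->
  forall i m, dim_ge p (socle_at p U i) [set 0] m.
Proof.
move=> finr0 i m; have [[N UN]|//] := unbounded_dim i m.
(* The exponent is [N.+1] because the final rank ranges over positive exponents, and [N] may be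
   0. *)
case: finr0; apply/card_le0P; case: U_finr => _; apply=> [|]; first exact: (ltn0Sn N).
have U0 x : mulset (p ^ N.+1)%N U x -> x = 0.
  by move=> [y Uy <-]; rewrite -pmulrn expnSr mulrnA UN ?mul0rn.
split; first by split=> // s c _ s0 _ a /s0.
move=> Y [YU Yord _] _; apply/seteqP; split=> // y Yy.
have [k k0 yk] := Yord y Yy; have := yk 1%N.
rewrite (U0 y (YU y Yy)) mul0rn eqxx dvdn1 => /esym/eqP pk1.
have : (1 ^ k < p ^ k)%N by rewrite ltn_exp2r // prime_gt1.
by rewrite exp1n pk1.
Qed.

Lemma final_rank_empty : [set: finr] = set0 -> exists N, forall x, U x -> x *+ p ^ N = 0.
Proof.
move=> finr0; have [[n n0 [X Xmax finrX]] _] := U_finr.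
have [//|] := unbounded_dim n 1.
have [e eb] := maximal_independent_basis p_prime
  (mulset_subgroup (p ^ n)%N first_ulm_subgroup) Xmax.
move=> /(dim_basis p_prime 1 eb); rewrite -(card_le_eqr finrX) finr0.
by move=> /card_geP[f [_ /(_ ord0)]].
Qed.

Lemma sum_infinite : infinite_set [set: kappa0 + finr] ->
  infinite_set [set: kappa0] \/ [set: finr] <> set0.
Proof.
move=> inf; have [k0|] := pselect (finite_set [set: kappa0]); [right=> f0 | by left].
apply: inf; have -> : [set: kappa0 + finr] = inl @` [set: kappa0] `|` inr @` [set: finr].
  by apply/seteqP; split=> // -[x|x] _; [left; exists x | right; exists x].
by rewrite f0 image_set0 setU0; apply: finite_image.
Qed.

Lemma inf_socle_infinite : infinite_set [set: kappa0 + finr] ->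
  forall i m, dim_ge p (@inf_socle p A i) [set 0] m.
Proof.
have [Ds _ _ _] := DR.
move=> /sum_infinite[/infinite_card_ge k0|/final_rank_nonempty Ud] i m.
  have [X Xmax k0X] := D_rank.
  have [e eb] := maximal_independent_basis p_prime Ds Xmax.
  apply: (dim_ge_le (@divisible_inf_socle i)); apply/(dim_basis p_prime m eb).
  by rewrite -(card_le_eqr k0X).
exact: (dim_ge_le (@first_ulm_inf_socle i)).
Qed.

(** A nonempty final rank makes all socles infinite, hence is itself infinite; a finite one is
    therefore zero. *)
Lemma rank_finite : ~ infinite_set [set: kappa0 + finr] ->
  finite_set [set: kappa0] /\ [set: finr] = set0.
Proof.
move=> fin; split; apply: contrapT => inf; apply: fin => sum_fin; apply: inf.
  have := finite_preimage (f := inl) (B := [set: kappa0 + finr]) _ sum_fin.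
  rewrite preimage_setT; apply=> x y _ _ [->] //.
have finr_fin : finite_set [set: finr].
  have := finite_preimage (f := inr) (B := [set: kappa0 + finr]) _ sum_fin.
  rewrite preimage_setT; apply=> x y _ _ [->] //.
apply: contrapT => finr0; have [[n n0 [X Xmax finrX]] _] := U_finr.
have [e eb] := maximal_independent_basis p_prime
  (mulset_subgroup (p ^ n)%N first_ulm_subgroup) Xmax.
case: ((infinite_card_ge [set: finr]).2 _ finr_fin) => m.
rewrite (card_le_eqr finrX); apply/(dim_basis p_prime m eb).
exact: final_rank_nonempty.
Qed.

Variables (C : set A) (Ci : nat -> set A) (gamma : nat -> choiceType).
Variable UC : basic_decomposition p U C Ci gamma.

Lemma bounded_gamma N : (forall x, U x -> x *+ p ^ N = 0) ->
  forall k, (N < k)%N -> [set: gamma k] = set0.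
Proof.
move=> UN k Nk; apply/seteqP; split=> // j _.
pose u := Tagged gamma j.
suff p1 : (p %| (1 : int))%Z by have := prime_ndvd1 p_prime; rewrite p1.
apply: (@socle_gen_free _ p_prime _ _ _ _ _ UC k [:: u] (fun=> 1) isT) => //.
- by move=> v; rewrite inE => /eqP -> /=; rewrite leqnn (leq_trans _ Nk).
- have [w Cw uw] := socle_gen_root UC u.
  rewrite big_seq1 mulr1z uw /= -(subnKC (_ : N <= k.-1)%N) ?expnD ?mulrnA ?UN ?mul0rn.
  + by apply: sg0; apply: mulset_subgroup first_ulm_subgroup.
  + exact: (basic_sub UC).
  + by case: k Nk {j u uw}.
- exact: mem_head.
Qed.

(** Since p^N U = 0, freeness and spanning modulo p^N U hold outright, with no need to identify [C]
    with [U]. *)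
Lemma bounded_socle_basis N i : (forall x, U x -> x *+ p ^ N = 0) ->
  basis_mod p (socle_at p U i) [set 0] (interval_sum gamma i.+1 N) (socle_gen UC).
Proof.
move=> UN; have Us := first_ulm_subgroup; split.
- exact: zero_subgroup.
- move=> u /andP[iu _]; split; last exact: socle_gen_p.
  have [w Cw ->] := socle_gen_root UC u.
  exists (w *+ p ^ ((tag u).-1 - i)); first exact: (sgMn Us _ (basic_sub UC Cw)).
  by rewrite -pmulrn -mulrnA -expnD subnK //; case: (tag u) iu.
- by move=> u _; rewrite /= socle_gen_p.
- move=> s c su sX /= s0; apply: (@socle_gen_free _ p_prime _ _ _ _ _ UC N s c su) => //.
    by move=> u /sX /andP[iu uN] /=; rewrite uN (leq_trans _ iu).
  by rewrite s0; apply: sg0; apply: mulset_subgroup.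
move=> x [xi px]; have UN0 : mulset (p ^ N)%N U `<=` [set 0].
  by move=> _ [y Uy <-] /=; rewrite -pmulrn UN.
have [iN|Ni] := leqP i N.
  by apply: (span_mod_le UN0); apply: (socle_gen_span p_prime Us UC iN).
apply: span_mod_base; apply: UN0; case: xi => y Uy <-.
exists (y *+ p ^ (i - N)); first exact: (sgMn Us).
by rewrite -!pmulrn -mulrnA -expnD subnK // ltnW.
Qed.

Lemma inf_socle_finite N n i q : (forall x, U x -> x *+ p ^ N = 0) ->
    [set: kappa0] #= `I_n ->
  dim_ge p (@inf_socle p A i) [set 0] q <-> `I_(q - n) #<= interval_sum gamma i.+1 N.
Proof.
move=> UN k0n; have [Ds _ _ _] := DR; have Us := first_ulm_subgroup.
have [X Xmax k0X] := D_rank.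
have [e eb] := maximal_independent_basis p_prime Ds Xmax.
have basis := sum_basis (P := @inf_socle p A i) DR _ _ (@divisible_inf_socle i)
  (@first_ulm_inf_socle i) _ eb (bounded_socle_basis i UN).
rewrite (dim_basis p_prime q (basis _ _ _)).
- by apply: sum_set_card_ge; apply: card_eq_trans (card_esym k0X) k0n.
- by move=> x [].
- by move=> _ [[y Uy <-] _]; apply: first_ulm_sub; exact: (sgMz Us).
move=> x [px [w /infinite_height_decomp[d [r [Dd Ur wE]]] xE]].
have Rs : is_subgroup R by case: DR.
have Ddi : D (d *+ p ^ i) by apply: sgMn.
have Rri : R (r *+ p ^ i) by apply: sgMn => //; apply: first_ulm_sub.
have split0 : d *+ p ^ i *+ p = - (r *+ p ^ i *+ p).
  by apply/eqP; rewrite -addr_eq0 -!mulrnDl -wE -xE px.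
have d0 : d *+ p ^ i *+ p = 0.
  have : (D `&` R) (d *+ p ^ i *+ p).
    by split; [exact: (sgMn Ds) | rewrite split0; apply: (sgN Rs); exact: (sgMn Rs)].
  by case: DR => _ _ ->.
exists (d *+ p ^ i), (r *+ p ^ i); split.
- by split.
- by split; [exists r | apply/eqP; rewrite -oppr_eq0 -split0 d0].
- by rewrite xE wE mulrnDl.
Qed.

(** The bound [N'] may be enlarged at will, so that two groups can be compared with a common one. *)
Lemma inf_socle_profile :
  (infinite_set [set: kappa0 + finr] /\
     forall i m, dim_ge p (@inf_socle p A i) [set 0] m) \/
  exists n N, [/\ [set: kappa0] #= `I_n, [set: finr] = set0 & forall N', (N <= N')%N ->
    (forall k, (N' < k)%N -> [set: gamma k] = set0) /\
    forall i q, dim_ge p (@inf_socle p A i) [set 0] q <->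
      `I_(q - n) #<= interval_sum gamma i.+1 N'].
Proof.
have [inf|/rank_finite[[n k0n] finr0]] := pselect (infinite_set [set: kappa0 + finr]).
  by left; split=> //; apply: inf_socle_infinite.
right; have [N UN] := final_rank_empty finr0; exists n, N; split=> // N' NN'.
have UN' x : U x -> x *+ p ^ N' = 0.
  by move=> /UN xN; rewrite -(subnKC NN') expnD mulrnA xN mul0rn.
by split=> [|i q]; [exact: bounded_gamma | exact: inf_socle_finite].
Qed.

End Invariants.

(** * Comparison of the two groups *)

Lemma interval_sum_empty (gamma : nat -> choiceType) i N :
  (N < i)%N -> interval_sum gamma i N = set0.
Proof.
move=> Ni; apply/seteqP; split=> // u /andP[iu uN].
by have := leq_trans Ni (leq_trans iu uN); rewrite ltnn.
Qed.

Lemma interval_sum_stable (gamma : nat -> choiceType) i N N' : (N <= N')%N ->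
    (forall k, (N < k)%N -> [set: gamma k] = set0) ->
  interval_sum gamma i N' = interval_sum gamma i N.
Proof.
move=> NN' gamma0; apply/seteqP; split=> u /andP[iu uN]; apply/andP; split=> //.
  rewrite leqNgt; apply/negP => /gamma0 e.
  by have : [set: gamma (tag u)] (tagged u) by []; rewrite e.
exact: leq_trans NN'.
Qed.

Lemma card_ge_empty T k : `I_k #<= (set0 : set T) <-> k = 0%N.
Proof.
split=> [/card_geP[f [_ f0]]|->]; last by rewrite II0.
by case: k f f0 => // k f /(_ ord0).
Qed.

Lemma p_group_torsion (p : nat) (A : zmodType) : p_group p [set: A] -> torsion p A.
Proof. by move=> Ap x; have [k xk] := Ap x I; exists k; apply/eqP; rewrite xk. Qed.

Theorem theorem6p3 (p : nat) (p_prime : prime p) (A A' : zmodType)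
    (A_p : p_group p [set: A]) (A'_p : p_group p [set: A'])
    (D R : set A) (D' R' : set A')
    (A_DR : direct_sum2 D R [set: A]) (A'_DR : direct_sum2 D' R' [set: A'])
    (D_div : divisible D) (D'_div : divisible D')
    (R_red : reduced R) (R'_red : reduced R')
    (kappa0 kappa0' : Type)
    (D_rank : has_rank p D kappa0) (D'_rank : has_rank p D' kappa0')
    (B : set A) (Bi : nat -> set A) (kappa : nat -> choiceType)
    (B_basic : basic_decomposition p R B Bi kappa)
    (B' : set A') (Bi' : nat -> set A') (kappa' : nat -> choiceType)
    (B'_basic : basic_decomposition p R' B' Bi' kappa')
    (C : set A) (Ci : nat -> set A) (gamma : nat -> choiceType)
    (C_basic : basic_decomposition p (first_ulm p R) C Ci gamma)
    (C' : set A') (Ci' : nat -> set A') (gamma' : nat -> choiceType)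
    (C'_basic : basic_decomposition p (first_ulm p R') C' Ci' gamma')
    (finr finr' : Type)
    (finr_A1 : has_final_rank p (first_ulm p R) finr)
    (finr_A'1 : has_final_rank p (first_ulm p R') finr') :
  tp A = tp A' <->
  (forall i : nat, (1 <= i)%N -> card_approx [set: kappa i] [set: kappa' i]) /\
  ((infinite_set [set: kappa0 + finr] /\ infinite_set [set: kappa0' + finr'])
   \/
   [/\ [/\ finite_set [set: kappa0], finite_set [set: kappa0']
         & [set: kappa0] #= [set: kappa0']],
       [set: finr] = set0, [set: finr'] = set0
     & exists N : nat,
         (forall k : nat, (N < k)%N ->
            [set: gamma k] = set0 /\ [set: gamma' k] = set0) /\
         (forall i : nat, (1 <= i <= N)%N ->
            card_approx (interval_sum gamma i N) (interval_sum gamma' i N))]).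

Proof.
have Ap := p_group_torsion A_p; have A'p := p_group_torsion A'_p.
have ulmE := ulm_num_card p_prime A_DR D_div B_basic.
have ulmE' := ulm_num_card p_prime A'_DR D'_div B'_basic.
have prof := inf_socle_profile p_prime Ap A_DR D_div R_red D_rank finr_A1 C_basic.
have prof' := inf_socle_profile p_prime A'p A'_DR D'_div R'_red D'_rank finr_A'1 C'_basic.
rewrite (tp_invariants p_prime Ap A'p).
apply: (iff_trans (B := (forall i : nat, (1 <= i)%N ->
    card_approx [set: kappa i] [set: kappa' i]) /\ forall i m,
    dim_ge p (@inf_socle p A i) [set 0%R] m <-> dim_ge p (@inf_socle p A' i) [set 0%R] m)).
  split=> -[ulm inf]; split=> //.
    by case=> // h _; apply/card_approxP => m; rewrite -ulmE -ulmE'.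
  by move=> h m; rewrite ulmE ulmE'; apply: (card_approxP _ _).1; apply: ulm.
split=> -[kappaE H]; split=> //.
  case: prof => [[inf dimA]|[n [N [k0n finr0 dimA]]]];
    case: prof' => [[inf' dimA']|[n' [N' [k0n' finr0' dimA']]]].
  - by left.
  (* At index [N'] the interval is empty and the dimension is exactly [n'], so it cannot reach
     [n'.+1]. *)
  - have [_ dimN] := dimA' N' (leqnn N'); have := (H N' n'.+1).1 (dimA _ _).
    by rewrite dimN subSnn interval_sum_empty // => /card_ge_empty.
  - have [_ dimN] := dimA N (leqnn N); have := (H N n.+1).2 (dimA' _ _).
    by rewrite dimN subSnn interval_sum_empty // => /card_ge_empty.
  pose M := maxn N N'.
  have [gamma0 dimM] := dimA M (leq_maxl _ _).
  have [gamma0' dimM'] := dimA' M (leq_maxr _ _).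
  (* At index [M] both intervals are empty, and only the ranks of the divisible parts remain. *)
  have nn' q : (q <= n)%N = (q <= n')%N.
    have := H M q; rewrite dimM dimM' !interval_sum_empty // !card_ge_empty.
    by move=> qE; apply/idP/idP; rewrite -!subn_eq0 => /eqP/qE ->.
  have {nn'} nE : n = n' by apply/eqP; rewrite eqn_leq nn' leqnn -nn' leqnn.
  subst n'; right; split=> //.
    by split; [exists n | exists n | apply: card_eq_trans k0n (card_esym k0n')].
  exists M; split=> [k Mk|[//|i] _]; first by split; [apply: gamma0 | apply: gamma0'].
  (* Testing dimension [n + m] cancels the rank [n] of the divisible parts. *)
  apply/card_approxP => m; have := H i (n + m)%N.
  by rewrite dimM dimM' addKn.
case: H => [[inf inf'] i m|[[k0 k0' k0E] finr0 finr0' [M [gammaM approxM]]] i q].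
  case: prof => [[_ dimA]|[n [N [k0n finr0 _]]]]; last first.
    by case: (sum_infinite inf) => // -[]; exists n.
  case: prof' => [[_ dimA']|[n' [N' [k0n' finr0' _]]]]; last first.
    by case: (sum_infinite inf') => // -[]; exists n'.
  by split=> _.
case: prof => [[inf _]|[n [N [k0n _ dimA]]]]; first by case: (sum_infinite inf).
case: prof' => [[inf' _]|[n' [N' [k0n' _ dimA']]]]; first by case: (sum_infinite inf').
(* Both dimension formulas hold with bound [L], and beyond [M] no [gamma] contributes. *)
pose L := maxn M (maxn N N').
have ML : (M <= L)%N := leq_maxl _ _.
have [|_ ->] := dimA L; first by rewrite /L !leq_max leqnn orbT.
have [|_ ->] := dimA' L; first by rewrite /L !leq_max leqnn !orbT.
have <- : n = n'.
  apply/card_eq_II/(card_eq_trans (card_esym k0n)).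
  exact: card_eq_trans k0E k0n'.
rewrite !(interval_sum_stable _ ML); [|by move=> k /gammaM[]..].
have [iM|Mi] := leqP i.+1 M; last by rewrite !interval_sum_empty // !card_ge_empty.
by apply: (card_approxP _ _).1; apply: approxM.
Qed.
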